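(* Let $(V,\omega,\mu)$ be an infinite weighted graph satisfying Assumption (A) (see context), with pseudo metric $d$, point $x_0\in V$ and constants $R_0>1$, $\alpha\in[0,1]$ as in Assumption (A). Let $v:V\times[0,\infty)\to\mathbb{R}$ be a positive function, let $\sigma>1$, and let $\theta_1\ge 2$, $\theta_2\ge 2$ be such that $\frac{\theta_1}{\theta_2}\ge\frac{1+\alpha}{2}$. Let $u_0,u_1:V\to\mathbb{R}$. Suppose that: (1) there is a constant $C>0$ such that for every $R\ge R_0$ $$\int_0^{\infty}\sum_{x\in V}\mathbf 1_{E_R}(x,t)\,v^{-\frac{1}{\sigma-1}}(x,t)\,\mu(x)\,dt\le C R^{\frac{(1+\alpha)\sigma}{\sigma-1}},$$ where $E_R:=\{(x,t)\in V\times[0,\infty): R^{\theta_1}\le d(x,x_0)^{\theta_1}+t^{\theta_2}\le 2R^{\theta_1}\}$; (2) $$\liminf_{R\to\infty}\Big\{\sum_{x\in B_R(x_0)}u_1^+(x)\mu(x)-\sum_{x\in B_{2R}(x_0)}u_1^-(x)\mu(x)\Big\}\ge 0.$$ Let $u:V\times[0,\infty)\to\mathbb{R}$ be a non-negative very weak solution of $$u_{tt}-\Delta u\ge v|u|^\sigma\ \text{ in }V\times(0,\infty),\qquad u=u_0\ \text{ in }V\times\{0\},\qquad u_t=u_1\ \text{ in }V\times\{0\}.$$ Then $u\equiv 0$.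
   Context: Weighted graph: a triple $(V,\omega,\mu)$ where $V$ is a countable set, $\mu:V\to(0,\infty)$, and $\omega:V\times V\to[0,\infty)$ satisfies $\omega_{xy}=\omega_{yx}$, $\omega_{xx}=0$ and $\sum_{y\in V}\omega_{xy}<\infty$ for all $x,y\in V$. Write $x\sim y$ if $\omega_{xy}>0$. The graph is locally finite if each $x$ has finitely many $y\sim x$; connected if any two distinct vertices are joined by a finite path $x_0\sim x_1\sim\dots\sim x_n$; undirected if edges have no orientation (automatic from symmetry of $\omega$). Laplacian: $\Delta f(x)=\frac{1}{\mu(x)}\sum_{y\sim x}\omega_{xy}\,(f(y)-f(x))$ for $f:V\to\mathbb{R}$; for functions on $V\times[0,\infty)$ it acts in the variable $x$. A pseudo metric on $V$ is a symmetric map $d:V\times V\to[0,\infty)$ with $d(x,x)=0$ satisfying the triangle inequality (possibly $d(x,y)=0$ for $x\ne y$). Its jump size is $j:=\sup\{d(x,y):x,y\in V,\ \omega_{xy}>0\}$. Balls: $B_r(x)=\{y\in V:d(x,y)<r\}$. Assumption (A): (i) $(V,\omega,\mu)$ is connected, locally finite, undirected; (ii) there is $C>0$ such that $\sum_{y\sim x}\omega_{xy}\le C\mu(x)$ for every $x\in V$; (iii) there is a pseudo metric $d$ on $V$ whose jump size $j$ is finite; (iv) for this $d$, $B_r(x)$ is a finite set for all $x\in V$, $r>0$; (v) for some $x_0\in V$, $R_0>1$, $\alpha\in[0,1]$, $C>0$, $\Delta d(x,x_0)\le \frac{C}{d^\alpha(x,x_0)}$ for every $x\in V\setminus B_{R_0}(x_0)$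 (Laplacian taken in $x$). Notation: $\mathbf 1_\Omega$ is the characteristic function of $\Omega$; $a^+=\max\{a,0\}$, $a^-=\max\{-a,0\}$. Very weak solution: $u:V\times[0,\infty)\to\mathbb{R}$ with $u(x,\cdot)\in L^1_{loc}([0,\infty))\cap L^\sigma_{loc}([0,\infty),v(x,t)dt)$ for every $x\in V$, such that $$\int_0^\infty\sum_{x\in V}u\,\varphi_{tt}\,\mu(x)\,dt-\int_0^\infty\sum_{x\in V}\Delta u\,\varphi\,\mu(x)\,dt+\sum_{x\in V}u_0(x)\varphi_t(x,0)\mu(x)-\sum_{x\in V}u_1(x)\varphi(x,0)\mu(x)\ge\int_0^\infty\sum_{x\in V}v|u|^\sigma\varphi\,\mu(x)\,dt$$ for every $\varphi:V\times[0,\infty)\to\mathbb{R}$ with $\varphi\ge0$, $\operatorname{supp}\varphi\subset A\times[0,T]$ for some $T>0$ and some finite $A\subset V$, and $\varphi(x,\cdot)\in C^2([0,\infty))$ for every $x\in V$. Conventions: $v(x,\cdot)$ is Lebesgue measurable for each $x$; functions $u(x,\cdot)$ are identified when equal almost everywhere, so $u\equiv0$ means $u(x,t)=0$ for every $x\in V$ and a.e. $t\ge0$. *)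

(* Defs.v *)
From HB Require Import structures.
From mathcomp Require Import all_boot all_order all_algebra.
From mathcomp Require Import all_classical all_reals all_analysis.

Set Implicit Arguments.
Unset Strict Implicit.
Unset Printing Implicit Defensive.

Import Order.TTheory GRing.Theory Num.Theory.
Import numFieldNormedType.Exports.

Local Open Scope classical_set_scope.
Local Open Scope ring_scope.

(* [lebesgue_measure] only lives on the Borel sigma-algebra; its completion
   lives on the Lebesgue (i.e. Caratheodory) one. *)
Notation leb := completed_lebesgue_measure.

Section Lebesgue.
Context {R : realType}.

Definition lebesgue_measurable_fun (D : set R) (f : R -> R) : Prop :=
  measurable_fun
    (D : set (caratheodory_type (mu_ext (@wlength R idfun)))) f.

Definition L1loc_ray (f : R -> R) : Prop :=
  forall T : R, 0 < T -> leb.-integrable `[0, T] (EFin \o f).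

End Lebesgue.

(* A function on [0, +oo[ is represented by a function on R whose values at
   negative arguments play no role: the limits below are taken within
   [0, +oo[, so that the derivative at 0 is one-sided. *)
Section RayCalculus.
Context {R : realType}.
Implicit Type f : R -> R.

Definition ray_quotient f (t s : R) : R := (f s - f t) / (s - t).

Definition ray_derivable f (t : R) : Prop :=
  cvg (ray_quotient f t s @[s --> within `[0, +oo[ t^']).

Definition ray_derive f (t : R) : R :=
  lim (ray_quotient f t s @[s --> within `[0, +oo[ t^']).

Definition C2_ray f : Prop :=
  [/\ forall t, 0 <= t -> ray_derivable f t,
      forall t, 0 <= t -> ray_derivable (ray_derive f) t
    & {within `[0, +oo[, continuous (ray_derive (ray_derive f))}].

End RayCalculus.

Section WeightedGraphs.
Context {R : realType} {V : countType}.
Implicit Types (omega : V -> V -> R) (mu : V -> R) (d : V -> V -> R).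

Record weighted_graph omega mu : Prop := {
  vertex_weight_gt0 : forall x, 0 < mu x ;
  edge_weight_ge0 : forall x y, 0 <= omega x y ;
  edge_weight_sym : forall x y, omega x y = omega y x ;
  edge_weight_irr : forall x, omega x x = 0 ;
  edge_weight_summable :
    forall x, (\esum_(y in [set: V]) (omega x y)%:E < +oo)%E }.

Definition adjacent omega : rel V := fun x y => 0 < omega x y.

Definition locally_finite omega : Prop :=
  forall x, finite_set [set y | adjacent omega x y].

Definition connected_graph omega : Prop :=
  forall x y, x != y ->
    exists s : seq V, path (adjacent omega) x s /\ last x s = y.

(* [\sum_(y \in A) F y] is the finite-support sum. It is the intended one
   when the graph is locally finite. *)
Definition laplacian omega mu (f : V -> R) (x : V) : R :=
  (mu x)^-1 * \sum_(y \in [set y | adjacent omega x y])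
                 omega x y * (f y - f x).

Record pseudo_metric d : Prop := {
  pseudo_metric_ge0 : forall x y, 0 <= d x y ;
  pseudo_metric_refl : forall x, d x x = 0 ;
  pseudo_metric_sym : forall x y, d x y = d y x ;
  pseudo_metric_triangle : forall x y z, d x z <= d x y + d y z }.

Definition jump_size omega d : \bar R :=
  ereal_sup [set (d p.1 p.2)%:E | p in [set p : V * V | 0 < omega p.1 p.2]].

Definition dball d (x : V) (r : R) : set V := [set y | d x y < r].

Record assumption_A omega mu d (x0 : V) (R0 alpha : R) : Prop := {
  A_connected : connected_graph omega ;
  A_locally_finite : locally_finite omega ;
  A_degree : exists2 C : R, 0 < C &
    forall x, \sum_(y \in [set y | adjacent omega x y]) omega x y <= C * mu x ;
  A_pseudo_metric : pseudo_metric d ;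
  A_jump_size : (jump_size omega d < +oo)%E ;
  A_finite_balls : forall x r, 0 < r -> finite_set (dball d x r) ;
  A_R0 : 1 < R0 ;
  A_alpha : 0 <= alpha <= 1 ;
  A_laplacian_dist : exists2 C : R, 0 < C &
    forall x, ~ dball d x0 R0 x ->
      laplacian omega mu (d ^~ x0) x <= C / d x x0 `^ alpha }.

End WeightedGraphs.

Section VeryWeakSolutions.
Context {R : realType} {V : countType}.
Variables (omega : V -> V -> R) (mu : V -> R).
Implicit Types phi u v : V -> R -> R.

(* As A x [0, T] is closed, it contains the support as soon as it contains the
   points where phi does not vanish. *)
Record test_function phi : Prop := {
  test_ge0 : forall x t, 0 <= t -> 0 <= phi x t ;
  test_support : exists (T : R) (A : set V), [/\ 0 < T, finite_set A &
    [set p : V * R | 0 <= p.2 /\ phi p.1 p.2 != 0] `<=` A `*` `[0, T]] ;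
  test_C2 : forall x, C2_ray (phi x) }.

(* For a test function phi, all the sums over V are finite and all the
   integrands are integrable on [0, +oo[. *)
Record very_weak_solution v (sigma : R) (u0 u1 : V -> R) u : Prop := {
  vws_L1 : forall x, L1loc_ray (u x) ;
  vws_Lsigma : forall x, L1loc_ray (fun t => v x t * `|u x t| `^ sigma) ;
  vws_ineq : forall phi, test_function phi ->
    \int[leb]_(t in `[0, +oo[)
        (\sum_(x \in [set: V])
          u x t * ray_derive (ray_derive (phi x)) t * mu x)
    - \int[leb]_(t in `[0, +oo[)
        (\sum_(x \in [set: V])
          laplacian omega mu (u ^~ t) x * phi x t * mu x)
    + \sum_(x \in [set: V]) u0 x * ray_derive (phi x) 0 * mu x
    - \sum_(x \in [set: V]) u1 x * phi x 0 * mu x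
    >= \int[leb]_(t in `[0, +oo[)
        (\sum_(x \in [set: V]) v x t * `|u x t| `^ sigma * phi x t * mu x) }.

End VeryWeakSolutions.

Definition annulus {R : realType} {V : countType} (d : V -> V -> R) (x0 : V)
    (theta1 theta2 r : R) : set (V * R) :=
  [set p | 0 <= p.2 /\
    r `^ theta1 <= d p.1 x0 `^ theta1 + p.2 `^ theta2 <= 2 * r `^ theta1].

(* Main.v *)
Require Import Defs.
From HB Require Import structures.
From mathcomp Require Import all_boot all_order all_algebra finmap.
From mathcomp Require Import all_classical all_reals all_analysis.
From mathcomp Require Import measurable_realfun.
From mathcomp Require Import ring lra.

(** The proof is the test function method. Let [z] be the level function
    [(d(x, x0)^theta1 + t^theta2) / r^theta1], whose values between [1] and [2]
    define the annulus of radius [r], and test the inequality with a high power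
    [phi] of a cutoff of [z] that equals [1] for [z <= 3/2] and [0] for [z >= 2].

    Since [theta2 > 1], the time derivative of [phi] vanishes at time [0], so that
    [u0] drops out, and the term in [u1] is at least the difference in the second
    hypothesis ([velocity_gap_le]). After summation by parts in space
    ([laplacian_symmetric]) it remains to bound [phi_tt - Delta phi] from above. It
    is nonpositive off the annulus once [r] is large, because the jump size is
    finite; on the annulus it is at most
    [c r^(-(1 + alpha)) plateau^(n + 1)] ([profile2_laplacian_le]). For the time
    derivatives this is the condition on [theta1 / theta2]. For the Laplacian one
    expands to second order: convexity gives the inequality in the right direction,
    the first-order terms sum up to the Laplacian of the distance, and the
    second-order terms are of order [r^(-2)].

    Let [E(r)] be the integral of [v u^sigma phi] and [J(r)] the part of it over the
    annulus. Young's inequality with a free weight [K], together with the growth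
    hypothesis on [v], yields ([energy_le])
    [E(r) <= K J(r) + c K^(-1/(sigma - 1)) + o(1)].
    As [J <= E], the choice [K = 1/2] shows that [E] is bounded. As [E] is monotone
    and [J(r) <= E(2 r) - E(r / 2)] ([annulus_energy_le_increment]), [J] tends to
    [0]. Letting [r] tend to infinity and then [K], one obtains [E = 0]
    ([energy_vanishes]), and [v > 0] forces [u = 0] almost everywhere. *)

Set Implicit Arguments.
Unset Strict Implicit.
Unset Printing Implicit Defensive.

Import Order.TTheory GRing.Theory Num.Theory.
Import numFieldNormedType.Exports.

Local Open Scope classical_set_scope.
Local Open Scope ring_scope.

(** * One-sided derivatives on the half-line *)

Section ray_calculus.
Context {R : realType}.
Implicit Types (f g : R -> R) (t l : R).

(** The filter of the limits that define [ray_derive] at [t]. *)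
Definition ray_filter t := within `[0, +oo[%classic t^'.

Definition ray_has_derive f t l : Prop :=
  ray_quotient f t s @[s --> ray_filter t] --> l.

Lemma ray_filter_proper t : 0 <= t -> ProperFilter (ray_filter t).
Proof.
move=> t0; apply: Build_ProperFilter_ex => // P [e /= e0 He].
exists (t + e / 2); apply: He => /=.
- by rewrite opprD addrA subrr sub0r normrN gtr0_norm; lra.
- by rewrite gt_eqF//; lra.
- by rewrite in_itv/= andbT; lra.
Qed.

Lemma near_ray_filter_neq t : \forall s \near ray_filter t, s != t.
Proof.
by apply: filter_app (near_withinT _ _); near=> s; near: s; exists 1 => /=.
Unshelve. all: by end_near. Qed.

Lemma near_ray_filter_ge0 t : \forall s \near ray_filter t, 0 <= s.
Proof.
rewrite /ray_filter near_withinE; apply: nearW => s.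
by rewrite /= in_itv/= andbT.
Qed.

Lemma ray_has_derive_eq f g t l : 0 <= t -> (forall s, 0 <= s -> f s = g s) ->
  ray_has_derive f t l -> ray_has_derive g t l.
Proof.
move=> t0 fg; apply: cvg_trans; apply: near_eq_cvg.
near=> s; rewrite /ray_quotient !fg//; near: s.
exact: near_ray_filter_ge0.
Unshelve. all: by end_near. Qed.

Lemma ray_deriveP f t l : 0 <= t -> ray_has_derive f t l ->
  ray_derivable f t /\ ray_derive f t = l.
Proof.
move=> t0 fl; have ? := ray_filter_proper t0; split.
  by rewrite /ray_derivable; apply/cvg_ex; exists l.
exact: (cvg_lim _ fl).
Qed.

Lemma cvg_ray_filter t : s @[s --> ray_filter t] --> t.
Proof.
apply: cvg_within_filter; exact: cvg_within.
Qed.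

Lemma ray_has_derive_cvg f t l : ray_has_derive f t l ->
  f s @[s --> ray_filter t] --> f t.
Proof.
move=> fl; have : f t + ray_quotient f t s * (s - t) @[s --> ray_filter t] -->
    f t + l * (t - t).
  apply: cvgD; first exact: cvg_cst.
  apply: cvgM => //; apply: cvgB; [exact: cvg_ray_filter|exact: cvg_cst].
rewrite subrr mulr0 addr0; apply: cvg_trans; apply: near_eq_cvg.
near=> s; rewrite /ray_quotient divfK ?subrKC// subr_eq0.
by near: s; exact: near_ray_filter_neq.
Unshelve. all: by end_near. Qed.

(** The outer function has an ordinary two-sided derivative, so it has a
    Caratheodory slope [q] that is continuous at [f t]; only the inner difference
    quotient is one-sided, and [q] passes to the limit along it. *)
Lemma ray_has_derive_comp f g t l m : ray_has_derive f t l ->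
  is_derive (f t) 1 g m -> ray_has_derive (g \o f) t (m * l).
Proof.
move=> fl /is_derive1_caratheodory[q [gE qc qm]].
have : q (f s) * ray_quotient f t s @[s --> ray_filter t] --> m * l.
  apply: cvgM => //; rewrite -qm.
  exact: (cvg_comp _ _ (ray_has_derive_cvg fl) qc).
apply: cvg_trans; apply: near_eq_cvg.
by near=> s; rewrite /ray_quotient /= gE mulrA.
Unshelve. all: by end_near. Qed.

Lemma ray_has_deriveM f g t l m : ray_has_derive f t l ->
  ray_has_derive g t m -> ray_has_derive (fun s => f s * g s) t (l * g t + f t * m).
Proof.
move=> fl gm.
have : ray_quotient f t s * g s + f t * ray_quotient g t s
    @[s --> ray_filter t] --> l * g t + f t * m.
  apply: cvgD; apply: cvgM => //; [exact: ray_has_derive_cvg gm|exact: cvg_cst].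
apply: cvg_trans; apply: near_eq_cvg.
near=> s; rewrite /ray_quotient.
by rewrite mulrAC mulrA -mulrDl; congr (_ * _); ring.
Unshelve. all: by end_near. Qed.

Lemma ray_has_derive_affine f a b t l : ray_has_derive f t l ->
  ray_has_derive (fun s => a + b * f s) t (b * l).
Proof.
move=> fl; have : b * ray_quotient f t s @[s --> ray_filter t] --> b * l.
  by apply: cvgM => //; exact: cvg_cst.
apply: cvg_trans; apply: near_eq_cvg.
near=> s; rewrite /ray_quotient; field.
by rewrite subr_eq0; near: s; exact: near_ray_filter_neq.
Unshelve. all: by end_near. Qed.

(** At [t = 0] the difference quotient is the power [s `^ (p - 1)] itself, which
    tends to [0] when [1 < p] and is constantly [1] when [p = 1]. Both cases occur
    below, since the exponent [p] may be [theta2 - 1] with [theta2 = 2]. *)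
Lemma ray_has_derive_powR p t : 0 <= t -> 1 <= p ->
  ray_has_derive (fun s => s `^ p) t (p * t `^ (p - 1)).
Proof.
rewrite le_eqVlt => /predU1P[<-{t}|t0] p1.
  rewrite /ray_has_derive.
  have : s `^ (p - 1) @[s --> ray_filter 0] --> p * 0 `^ (p - 1).
    move: p1; rewrite le_eqVlt => /predU1P[<-|p1].
      rewrite subrr !powRr0 mulr1.
      under eq_cvg do rewrite powRr0.
      exact: cvg_cst.
    rewrite powR0 ?mulr0; last by rewrite subr_eq0 gt_eqF.
    have h : s `^ (p - 1) @[s --> 0^'+] --> (0 : R).
      by apply: powR_cvg0; rewrite subr_gt0.
    apply: cvg_trans h; apply: cvg_app => A /= [e e0 eA].
    exists e => //= s se s0 s1; apply: eA => //.
    rewrite lt_neqAle eq_sym; apply/andP; split => //.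
    by move: s1; rewrite in_itv/= andbT.
  apply: cvg_trans; apply: near_eq_cvg.
  near=> s.
  have s0 : 0 < s.
    rewrite lt_neqAle eq_sym; apply/andP; split; near: s.
      exact: near_ray_filter_neq.
    exact: near_ray_filter_ge0.
  rewrite /ray_quotient powR0 ?gt_eqF//; last lra.
  by rewrite !subr0 powRB ?(gt_eqF s0) ?implybT// powRr1// ltW.
have [g [gE gc gl]] := (is_derive1_caratheodory _ _ _).1 (@is_derive1_powR R p t t0).
rewrite /ray_has_derive -gl.
have : g s @[s --> ray_filter t] --> g t.
  exact: (cvg_comp _ _ (@cvg_ray_filter t) gc).
apply: cvg_trans; apply: near_eq_cvg.
near=> s; rewrite /ray_quotient gE mulfK// subr_eq0.
by near: s; exact: near_ray_filter_neq.
Unshelve. all: by end_near. Qed.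

End ray_calculus.

(** * A twice differentiable cutoff *)

Section cutoff.
Context {R : realType}.
Implicit Types (x y z : R) (m n : nat).

(** The truncated power, of class C^(m-1): composing these with polynomials gives
    cutoffs whose derivatives have explicit formulas and bounds. *)
Definition pos_pow m y : R := Num.max 0 y ^+ m.

Lemma pos_pow_ge0 m y : 0 <= pos_pow m y.
Proof. by rewrite exprn_ge0// le_max lexx. Qed.

Lemma pos_powT m y : 0 <= y -> pos_pow m y = y ^+ m.
Proof. by move=> y0; rewrite /pos_pow (max_idPr y0). Qed.

Lemma pos_powF m y : y <= 0 -> pos_pow m.+1 y = 0.
Proof. by move=> y0; rewrite /pos_pow (max_idPl y0) expr0n. Qed.

Lemma pos_pow_le1 m y : y <= 1 -> pos_pow m y <= 1.
Proof. by move=> y1; rewrite exprn_ile1// ?le_max ?lexx// ge_max ler01. Qed.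

Lemma pos_pow_exp k m y : (pos_pow k y) ^+ m = pos_pow (k * m) y.
Proof. by rewrite /pos_pow exprM. Qed.

Lemma continuous_pos_pow m : continuous (pos_pow m).
Proof.
move=> y.
apply: (@continuous_comp _ _ _ (@cst R R 0 \max id) (fun x : R => x ^+ m)).
  by apply: continuous_max; [exact: cvg_cst|exact: cvg_id].
exact: exprn_continuous.
Qed.

(** Away from [0] the function is locally a monomial or zero. At [0], the identity
    [pos_pow m.+2 z = pos_pow m.+1 z * z] is a Caratheodory decomposition. *)
Lemma is_derive_pos_pow m y :
  is_derive y 1 (pos_pow m.+2) (m.+2%:R * pos_pow m.+1 y).
Proof.
have [y0|y0|y0] := ltgtP y 0.
- rewrite pos_powF ?ltW// mulr0.
  apply: (@near_eq_is_derive _ _ _ (cst 0)).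
  near=> z; rewrite pos_powF// ltW//; near: z; exact: lt_nbhsl.
- rewrite pos_powT ?ltW//.
  apply: (@near_eq_is_derive _ _ _ ((@id R) ^+ m.+2)).
    near=> z; rewrite pos_powT// ?exprfctE// ltW//; near: z; exact: lt_nbhsr.
  by apply: is_derive_eq; rewrite /= /GRing.scale /= mulr1.
- rewrite y0 pos_powF// mulr0; apply/is_derive1_caratheodory.
  exists (pos_pow m.+1); split; last by rewrite pos_powF.
  + move=> z; rewrite (pos_powF _ (lexx 0)) !subr0 mulrC.
    have [z0|/ltW z0] := leP 0 z; last by rewrite !pos_powF// mulr0.
    by rewrite !pos_powT// -exprS.
  + exact: continuous_pos_pow.
Unshelve. all: by end_near. Qed.

Lemma ler_pos_pow m : {homo pos_pow m : x y / x <= y}.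
Proof.
move=> x y xy; apply: lerXn2r; rewrite ?nnegrE; first by rewrite le_max lexx.
  by rewrite le_max lexx.
by rewrite ge_max !le_max lexx xy orbT.
Qed.

(** Vanishes up to [3 / 2], is at least [1] from [2] on. Starting at [3 / 2] and
    not at [1] leaves a margin: a vertex of level below [1] has all its neighbours
    at a level below [3 / 2], where the cutoff is constant. *)
Definition ramp z := pos_pow 3 (2 * z - 3).

Definition plateau z := pos_pow 1 (1 - ramp z).

(** By [cutoffE] this is the [n]-th power of [plateau]. A high power makes the
    derivatives of the cutoff bounded by a smaller power of [plateau], which is what
    Young's inequality needs. *)
Definition cutoff n z := pos_pow n (1 - ramp z).

Definition cutoff1 n z :=
  - (n%:R * pos_pow n.-1 (1 - ramp z)) * (6 * pos_pow 2 (2 * z - 3)).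

Definition cutoff2 n z :=
  n%:R * n.-1%:R * pos_pow n.-2 (1 - ramp z) * (6 * pos_pow 2 (2 * z - 3)) ^+ 2
  - n%:R * pos_pow n.-1 (1 - ramp z) * (24 * pos_pow 1 (2 * z - 3)).

Lemma is_derive_affine z : is_derive z 1 (fun z => 2 * z - 3) 2.
Proof.
have -> : (fun z => 2 * z - 3) = (2 \*: (@id R)) + cst (- 3).
  by apply/funext.
by apply: is_derive_eq; rewrite /GRing.scale /= mulr1 subr0.
Qed.

Lemma is_derive_ramp z : is_derive z 1 ramp (6 * pos_pow 2 (2 * z - 3)).
Proof.
have h := @is_derive1_comp R (pos_pow 3) (fun z => 2 * z - 3) z _ _
  (is_derive_pos_pow 1 _) (is_derive_affine z).
by apply: (is_derive_eq h); ring.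
Qed.

Lemma is_derive_onem_ramp z :
  is_derive z 1 (fun z => 1 - ramp z) (- (6 * pos_pow 2 (2 * z - 3))).
Proof.
have h := is_deriveB (is_derive_cst (1 : R) z 1) (is_derive_ramp z).
by apply: (is_derive_eq h); rewrite sub0r.
Qed.

Lemma is_derive_cutoff n z :
  is_derive z 1 (cutoff n.+2) (cutoff1 n.+2 z).
Proof.
have h := @is_derive1_comp R (pos_pow n.+2) (fun z => 1 - ramp z) z _ _
  (is_derive_pos_pow n _) (is_derive_onem_ramp z).
by apply: (is_derive_eq h); rewrite /cutoff1/=; ring.
Qed.

Lemma is_derive_cutoff1 n z :
  is_derive z 1 (cutoff1 n.+3) (cutoff2 n.+3 z).
Proof.
have h := @is_derive1_comp R (pos_pow n.+2) (fun z => 1 - ramp z) z _ _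
  (is_derive_pos_pow n _) (is_derive_onem_ramp z).
have k := @is_derive1_comp R (pos_pow 2) (fun z => 2 * z - 3) z _ _
  (is_derive_pos_pow 0 _) (is_derive_affine z).
have hk := is_deriveM (is_deriveZ (- (6 * n.+3%:R)) h) k.
have -> : cutoff1 n.+3 =
    (- (6 * n.+3%:R) \*: (pos_pow n.+2 \o (fun z : R => 1 - ramp z))) *
    (pos_pow 2 \o (fun z : R => 2 * z - 3)).
  apply/funext => w; rewrite mulrfctE /cutoff1 /= /GRing.scale/=; ring.
by apply: (is_derive_eq hk); rewrite /cutoff2 /= /GRing.scale /=; ring.
Qed.

Lemma continuous_cutoff2 n : continuous (cutoff2 n).
Proof.
have ca : continuous (fun z : R => 2 * z - 3).
  move=> z; apply: cvgB; last exact: cvg_cst.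
  by apply: cvgM; [exact: cvg_cst|exact: cvg_id].
have cp k : continuous (fun z => pos_pow k (2 * z - 3)).
  move=> z; apply: (@continuous_comp _ _ _ (fun z : R => 2 * z - 3) (pos_pow k)).
    exact: ca.
  exact: continuous_pos_pow.
have cg k : continuous (fun z => pos_pow k (1 - ramp z)).
  move=> z; apply: (@continuous_comp _ _ _ (fun z => 1 - ramp z) (pos_pow k)).
    by apply: cvgB; [exact: cvg_cst|exact: cp].
  exact: continuous_pos_pow.
have cM (f g : R -> R) : continuous f -> continuous g ->
    continuous (fun z => f z * g z).
  by move=> cf cg' z; apply: cvgM; [exact: cf|exact: cg'].
have cc (c : R) : continuous (fun _ : R => c) by move=> z; exact: cvg_cst.
have cB (f g : R -> R) : continuous f -> continuous g ->
    continuous (fun z => f z - g z).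
  by move=> cf cg' z; apply: cvgB; [exact: cf|exact: cg'].
rewrite /cutoff2; apply: cB.
  apply: (cM); first by apply: (cM).
  have -> : (fun z : R => (6 * pos_pow 2 (2 * z - 3)) ^+ 2) =
    (fun z : R => (6 * pos_pow 2 (2 * z - 3)) * (6 * pos_pow 2 (2 * z - 3))).
    by apply/funext => z; rewrite expr2.
  by apply: (cM); apply: (cM).
by apply: (cM); apply: (cM).
Qed.

Lemma ramp_ge0 z : 0 <= ramp z. Proof. exact: pos_pow_ge0. Qed.

Lemma ramp0 z : z <= 3 / 2 -> ramp z = 0.
Proof. by move=> z32; rewrite /ramp pos_powF//; lra. Qed.

Lemma ramp_ge1 z : 2 <= z -> 1 <= ramp z.
Proof. by move=> z2; rewrite /ramp pos_powT; [rewrite exprn_ege1//|]; lra. Qed.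

Lemma plateau01 z : 0 <= plateau z <= 1.
Proof. by rewrite pos_pow_ge0 pos_pow_le1//; have := ramp_ge0 z; lra. Qed.

Lemma cutoffE n z : cutoff n z = plateau z ^+ n.
Proof. by rewrite /cutoff /plateau pos_pow_exp mul1n. Qed.

Lemma cutoff01 n z : 0 <= cutoff n z <= 1.
Proof.
by have /andP[? ?] := plateau01 z; rewrite cutoffE exprn_ge0// exprn_ile1.
Qed.

Lemma cutoff_eq1 n z : z <= 3 / 2 -> cutoff n z = 1.
Proof.
by move=> /ramp0; rewrite /cutoff => ->; rewrite subr0 pos_powT ?expr1n.
Qed.

Lemma cutoff_eq0 n z : 2 <= z -> cutoff n.+1 z = 0.
Proof. by move=> /ramp_ge1 ?; rewrite /cutoff pos_powF//; lra. Qed.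

Lemma cutoff_nonincr n : {homo cutoff n : x y /~ x <= y}.
Proof.
move=> x y xy; apply: ler_pos_pow; rewrite lerD2l lerN2.
by apply: ler_pos_pow; lra.
Qed.

Lemma cutoff12_eq0 n z : (z < 1) || (2 < z) ->
  cutoff1 n.+3 z = 0 /\ cutoff2 n.+3 z = 0.
Proof.
move=> /orP[z1|z2]; rewrite /cutoff1 /cutoff2/=.
  by rewrite !(pos_powF _ (_ : 2 * z - 3 <= 0)) ?mulr0 ?expr0n ?mulr0 ?subr0//=; lra.
have h := ramp_ge1 (ltW z2).
by rewrite !(pos_powF _ (_ : 1 - ramp z <= 0)) ?mulr0 ?mul0r ?mulr0 ?oppr0
  ?mul0r ?subr0//; lra.
Qed.

(** Each derivative costs one factor [plateau], so two derivatives of the power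
    [n.+3] leave [n.+1] factors; up to numerical constants, all other factors lie
    between [0] and [1]. *)
Lemma cutoff12_le n z : `|cutoff1 n.+3 z| <= 6 * n.+3%:R * plateau z ^+ n.+1 /\
  `|cutoff2 n.+3 z| <= 60 * n.+3%:R ^+ 2 * plateau z ^+ n.+1.
Proof.
have [z2|z2] := ltP 2 z.
  have [|-> ->] := @cutoff12_eq0 n z; first by rewrite z2 orbT.
  have /andP[? _] := plateau01 z.
  by rewrite normr0 !mulr_ge0 ?exprn_ge0.
have /andP[g0 g1] := plateau01 z.
have P k : pos_pow k (1 - ramp z) = plateau z ^+ k by rewrite /plateau pos_pow_exp mul1n.
set g := plateau z in P g0 g1 *.
have w k : 0 <= pos_pow k (2 * z - 3) <= 1 by rewrite pos_pow_ge0 pos_pow_le1//; lra.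
have gg : g ^+ n.+2 <= g ^+ n.+1 by rewrite exprS ler_piMl// exprn_ge0.
have g0' : 0 <= g ^+ n.+2 by exact: exprn_ge0.
rewrite /cutoff1 /cutoff2 /= !P.
have /andP[w0 w1] := w 2%N; have /andP[v0 v1] := w 1%N.
have N1 : 1 <= n.+3%:R :> R by rewrite ler1n.
have N2 : 0 <= (n.+2%:R : R) <= n.+3%:R by rewrite ler0n ler_nat leqnSn.
move: N1 N2; set N := n.+3%:R; set N' := n.+2%:R => N1 /andP[N2 N3].
have N0 : 0 <= N by lra.
move: w0 w1 v0 v1; set W := pos_pow 2 _; set U := pos_pow 1 _ => w0 w1 v0 v1.
move: gg g0'; set G := g ^+ n.+2; set H := g ^+ n.+1 => gg g0'.
clearbody N N' W U G H.
have WH : G * W <= H by nra.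
split.
  rewrite mulNr normrN ger0_norm; last by rewrite !mulr_ge0.
  have -> : N * G * (6 * W) = 6 * N * (G * W) by ring.
  by apply: ler_wpM2l => //; rewrite mulr_ge0.
have H0 : 0 <= H by lra.
have N2H : N * N' * H <= N ^+ 2 * H.
  by rewrite ler_wpM2r// expr2 ler_wpM2l//; lra.
have W2 : W ^+ 2 <= 1 by rewrite exprn_ile1.
have A : N * N' * H * (6 * W) ^+ 2 <= 36 * (N ^+ 2 * H).
  have -> : N * N' * H * (6 * W) ^+ 2 = 36 * (N * N' * H) * W ^+ 2 by ring.
  apply: (@le_trans _ _ (36 * (N * N' * H))); last lra.
  rewrite ler_piMr// !mulr_ge0//; lra.
have B : N * G * (24 * U) <= 24 * (N ^+ 2 * H).
  have -> : N * G * (24 * U) = 24 * (N * G * U) by ring.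
  rewrite ler_wpM2l//; apply: (@le_trans _ _ (N * G)).
    by rewrite ler_piMr// mulr_ge0//; lra.
  by rewrite expr2 -mulrA ler_wpM2l//; nra.
have A0 : 0 <= N * N' * H * (6 * W) ^+ 2.
  by rewrite !mulr_ge0// ?sqr_ge0//; lra.
have B0 : 0 <= N * G * (24 * U) by rewrite !mulr_ge0//; lra.
rewrite ler_norml; apply/andP; split; lra.
Qed.

(** Second-order Taylor bound for the [C^2] function [ramp], by comparing cubes of
    positive parts. The linear term is kept exact: summed over the neighbours of a
    vertex it produces the Laplacian of the distance, where cancellations matter. *)
Lemma ramp_sub_le x y : x <= 2 -> `|y - x| <= 1 / 2 ->
  ramp y - ramp x <= 6 * pos_pow 2 (2 * x - 3) * (y - x) + 16 * (y - x) ^+ 2.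
Proof.
move=> x2; rewrite ler_norml => /andP[xy1 xy2]; rewrite /ramp.
move E : (2 * x - 3) => a; move F : (2 * y - 3) => b.
have -> : y - x = (b - a) / 2 by lra.
have a1 : a <= 1 by lra.
have ab : -1 <= b - a <= 1 by lra.
have s0 := sqr_ge0 (b - a).
have [a0|a0] := leP a 0; have [b0|b0] := leP b 0;
  rewrite ?(pos_powF _ a0) ?(pos_powF _ b0) ?(pos_powT _ (ltW a0))
    ?(pos_powT _ (ltW b0)).
- by lra.
- have h : b ^+ 2 <= (b - a) ^+ 2 by rewrite lerXn2r ?nnegrE; lra.
  have k : b ^+ 3 <= b ^+ 2 by rewrite exprSr ler_piMr ?sqr_ge0; lra.
  by lra.
- have h : a ^+ 2 * (a - b) <= (b - a) ^+ 2.
    by have : 0 <= (a - b) * (a - b - a ^+ 2); [apply: mulr_ge0; nra|lra].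
  have k : 0 <= a ^+ 3 by rewrite exprn_ge0// ltW.
  by lra.
- by have : 0 <= (b - a) ^+ 2 * (4 - b - 2 * a); [apply: mulr_ge0; lra|lra].
Qed.

Lemma exprn_tangent n x y : 0 <= x -> 0 <= y ->
  x ^+ n.+1 + n.+1%:R * x ^+ n * (y - x) <= y ^+ n.+1.
Proof.
move=> x0 y0; elim: n => [|n ih]; first by rewrite expr0 !expr1; lra.
have := ler_wpM2l y0 ih; rewrite -exprS; apply: le_trans.
rewrite -subr_ge0 (_ : _ - _ = n.+1%:R * x ^+ n * (y - x) ^+ 2); last first.
  rewrite !exprS -!natr1; ring.
by rewrite mulr_ge0 ?sqr_ge0// mulr_ge0 ?exprn_ge0.
Qed.

End cutoff.

(** * Convexity estimates for real powers *)

Section powR_estimates.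
Context {R : realType}.
Implicit Types (a b p q M r : R).

(** Young's inequality for [b] and [a `^ (p - 1)], with the conjugate exponents [p]
    and [p / (p - 1)], expresses the convexity of the power through its tangents. *)
Lemma powR_tangent p a b : 1 <= p -> 0 <= a -> 0 <= b ->
  a `^ p + p * a `^ (p - 1) * (b - a) <= b `^ p.
Proof.
rewrite le_eqVlt => /predU1P[<-|p1] a0 b0.
  by rewrite subrr powRr0 !powRr1//; lra.
have p0 : 0 < p by lra.
have q0 : 0 < p / (p - 1) by rewrite divr_gt0//; lra.
have := @conjugate_powR R b (a `^ (p - 1)) p (p / (p - 1)) b0
  (powR_ge0 _ _) p0 q0.
have -> : p^-1 + (p / (p - 1))^-1 = 1 by field; lra.
move=> /(_ erefl).
rewrite -powRrM (_ : (p - 1) * (p / (p - 1)) = p); last by field; lra.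
have -> : p * a `^ (p - 1) * (b - a) = p * (b * a `^ (p - 1)) - p * a `^ p.
  by rewrite -(mulr_powRB1 a0 p0); ring.
move=> h.
have : p * (b * a `^ (p - 1)) <= b `^ p + (p - 1) * a `^ p.
  apply: (le_trans (ler_wpM2l (ltW p0) h)).
  by rewrite le_eqVlt; apply/orP; left; apply/eqP; field; lra.
lra.
Qed.

Lemma powR_sub_le p a b M : 1 <= p -> 0 <= a <= b -> b <= M ->
  b `^ p - a `^ p <= p * M `^ (p - 1) * (b - a).
Proof.
move=> p1 /andP[a0 ab] bM.
have := powR_tangent p1 (le_trans a0 ab) a0.
have : p * b `^ (p - 1) * (b - a) <= p * M `^ (p - 1) * (b - a).
  rewrite ler_wpM2r//; first lra.
  rewrite ler_wpM2l//; first lra.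
  by rewrite ge0_ler_powR// ?nnegrE; lra.
lra.
Qed.

Lemma powR_dist_le p a b M : 1 <= p -> 0 <= a <= M -> 0 <= b <= M ->
  `|b `^ p - a `^ p| <= p * M `^ (p - 1) * `|b - a|.
Proof.
move=> p1 /andP[a0 aM] /andP[b0 bM].
have [ab|/ltW ba] := leP a b.
  rewrite !ger0_norm ?subr_ge0//; first by rewrite powR_sub_le// a0.
  by rewrite ge0_ler_powR// ?nnegrE; lra.
rewrite distrC (distrC b) !ger0_norm ?subr_ge0//; first by rewrite powR_sub_le// b0.
by rewrite ge0_ler_powR// ?nnegrE; lra.
Qed.

(** Convexity bounds the increment by the slope at [b]; exchanging it for the slope
    at [a] costs the Lipschitz constant of the derivative times [(b - a) ^+ 2]. *)
Lemma powR_taylor_le p a b M : 2 <= p -> 0 <= a <= M -> 0 <= b <= M ->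
  b `^ p - a `^ p <=
  p * a `^ (p - 1) * (b - a) + p * (p - 1) * M `^ (p - 2) * (b - a) ^+ 2.
Proof.
move=> p2 aM bM.
have [/andP[a0 _] /andP[b0 _]] := (aM, bM).
have h := powR_tangent (_ : 1 <= p) b0 a0.
have {h} := h (_ : 1 <= p); [| lra..].
have k := powR_dist_le (_ : 1 <= p - 1) aM bM.
have {k} := k ltac:(lra).
rewrite (_ : p - 1 - 1 = p - 2); last by lra.
set A := a `^ (p - 1); set B := b `^ (p - 1); set N := M `^ _ => k h.
have : (B - A) * (b - a) <= (p - 1) * N * (b - a) ^+ 2.
  rewrite (le_trans (ler_norm _))// normrM -(real_normK (num_real (b - a))).
  by rewrite expr2 mulrA ler_wpM2r.
move=> /(ler_wpM2l (_ : 0 <= p)) => /(_ ltac:(lra)).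
lra.
Qed.

Lemma ge0_powR_le_cancel p a b : 0 < p -> 0 <= b -> a `^ p <= b `^ p -> a <= b.
Proof.
move=> p0 b0; apply: contra_le => ba.
by rewrite gt0_ltr_powR// nnegrE// (le_trans b0)// ltW.
Qed.

End powR_estimates.

(** * Variation of the level function between neighbours *)

Section level.
Context {R : realType}.
Implicit Types (th alpha D tau r j : R).

(** The quantity whose values between [1] and [2] define the space-time annulus of
    radius [r], with [tau = t `^ theta2] as the time contribution. *)
Definition level th r D tau : R := (D `^ th + tau) / r `^ th.

Lemma level_sub th r D (D' : R) tau :
  level th r D' tau - level th r D tau = (D' `^ th - D `^ th) / r `^ th.
Proof. by rewrite /level; ring. Qed.

Lemma le_two_powR th r : 1 <= th -> 0 <= r -> 2 * r `^ th <= (2 * r) `^ th.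
Proof.
move=> th1 r0; rewrite powRM// ler_wpM2r ?powR_ge0//.
by rewrite le1r_powR//; lra.
Qed.

Lemma level_le2_le th r D tau : 1 <= th -> 0 < r -> 0 <= D -> 0 <= tau ->
  level th r D tau <= 2 -> D <= 2 * r.
Proof.
move=> th1 r0 D0 tau0; rewrite /level ler_pdivrMr ?powR_gt0// => h.
apply: (@ge0_powR_le_cancel _ th); [lra|lra|].
apply: le_trans (le_two_powR th1 (ltW r0)); lra.
Qed.

Lemma powRM_div th r (k s : R) : 0 < r -> 0 <= k ->
  (k * r) `^ s / r `^ th = k `^ s * r `^ (s - th).
Proof.
move=> r0 k0; rewrite powRM// ?(ltW r0)// -mulrA powRB//.
by rewrite (gt_eqF r0) implybT.
Qed.

(** Below level [2] distances are at most [2 * r], hence at most [3 * r] at the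
    neighbours when the jump size is at most [r], so the mean value bound for
    [D `^ th] is of order [r `^ (th - 1)]. *)
Lemma level_dist_le th r D (D' : R) tau j : 1 <= th -> 0 < r -> j <= r ->
  0 <= D -> 0 <= D' -> `|D' - D| <= j -> 0 <= tau -> level th r D tau <= 2 ->
  `|level th r D' tau - level th r D tau| <= th * 3 `^ (th - 1) * j / r.
Proof.
move=> th1 r0 jr D0 D'0 DD' tau0 /(level_le2_le th1 r0 D0 tau0) Dr.
have D'r : D' <= 3 * r by move: DD'; rewrite ler_norml => /andP[]; lra.
rewrite level_sub normrM normfV (ger0_norm (powR_ge0 _ th)).
rewrite (le_trans (ler_wpM2r _ (@powR_dist_le _ th D D' (3 * r) _ _ _)))//.
- by rewrite invr_ge0 powR_ge0.
- by rewrite D0/=; lra.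
- by rewrite D'0.
have -> : th * (3 * r) `^ (th - 1) * `|D' - D| / r `^ th =
  th * ((3 * r) `^ (th - 1) / r `^ th) * `|D' - D| by ring.
rewrite powRM_div// (_ : th - 1 - th = - 1); last by ring.
rewrite powR_inv1; last lra.
have -> : th * (3 `^ (th - 1) / r) * `|D' - D| = th * 3 `^ (th - 1) / r * `|D' - D|.
  by ring.
have -> : th * 3 `^ (th - 1) * j / r = th * 3 `^ (th - 1) / r * j by ring.
by rewrite ler_wpM2l// !mulr_ge0 ?powR_ge0 ?invr_ge0//; lra.
Qed.

(** The first-order term keeps its sign, because it has to be summed against the
    edge weights to produce the Laplacian of the distance; the second-order term is
    of order [r `^ (- 2)]. *)
Lemma level_sub_le th r D (D' : R) tau j : 2 <= th -> 0 < r -> j <= r ->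
  0 <= D -> 0 <= D' -> `|D' - D| <= j -> 0 <= tau -> level th r D tau <= 2 ->
  level th r D' tau - level th r D tau <=
  th * (D `^ (th - 1) * (D' - D)) / r `^ th
  + th * (th - 1) * 3 `^ (th - 2) * j ^+ 2 * r `^ (- 2).
Proof.
move=> th2 r0 jr D0 D'0 DD' tau0 /(level_le2_le (_ : 1 <= th) r0 D0 tau0) Dr.
have {}Dr := Dr ltac:(lra).
have D'r : D' <= 3 * r by move: DD'; rewrite ler_norml => /andP[]; lra.
rewrite level_sub.
have := @powR_taylor_le _ th D D' (3 * r) th2; rewrite D0 D'0 => /(_ _ _).
move=> /(_ ltac:(lra) D'r) h.
have j2 : (D' - D) ^+ 2 <= j ^+ 2.
  rewrite -(real_normK (num_real (D' - D))) lerXn2r// ?nnegrE//.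
  exact: le_trans DD'.
have i0 : 0 <= (r `^ th)^-1 by rewrite invr_ge0 powR_ge0.
apply: (le_trans (ler_wpM2r i0 h)); rewrite mulrDl.
rewrite lerD//; first by rewrite mulrA.
have -> : th * (th - 1) * (3 * r) `^ (th - 2) * (D' - D) ^+ 2 / r `^ th =
  th * (th - 1) * ((3 * r) `^ (th - 2) / r `^ th) * (D' - D) ^+ 2 by ring.
rewrite powRM_div// (_ : th - 2 - th = - 2); last by ring.
have -> : th * (th - 1) * 3 `^ (th - 2) * j ^+ 2 * r `^ (- 2) =
  th * (th - 1) * (3 `^ (th - 2) * r `^ (- 2)) * j ^+ 2 by ring.
by rewrite ler_wpM2l// !mulr_ge0 ?powR_ge0//; lra.
Qed.

Lemma powR_le_alpha alpha r q : 1 <= r -> q <= - (1 + alpha) ->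
  r `^ q <= r `^ (- (1 + alpha)).
Proof. by move=> r1 qa; apply: ler_powR. Qed.

(** Summing the Taylor bounds over the neighbours [y] of a vertex of measure [m],
    with edge weights [w y] and distances [D' y] to the centre, turns the first-order
    terms into the Laplacian of the distance, which is at most [C2 / D `^ alpha] for
    [R0 <= D]. With the factor [D `^ (th - 1) / r `^ th] this has the order
    [r `^ (- (1 + alpha))], since [th - 1 - alpha] is nonnegative and [D <= 2 * r].
    For [D < R0] and for the second-order terms, the bound on the total edge weight
    gives the powers [r `^ (- th)] and [r `^ (- 2)], which are no larger. The first
    conclusion expresses that neighbours of a vertex of level below [1] stay where
    the cutoff equals [1]. *)
Lemma sum_ramp_level_le (th alpha R0 j C1 C2 : R) :
  2 <= th -> 0 <= alpha <= 1 -> 0 <= R0 -> 0 <= j -> 0 <= C1 -> 0 <= C2 ->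
  exists c r1 : R, [/\ 0 <= c, 1 <= r1 &
    forall (V : Type) (s : seq V) (w D' : V -> R) (m D tau r : R),
      r1 <= r -> 0 <= m -> 0 <= D -> 0 <= tau -> level th r D tau <= 2 ->
      (forall y, 0 <= w y) -> (forall y, 0 <= D' y) ->
      (forall y, 0 < w y -> `|D' y - D| <= j) ->
      \sum_(y <- s) w y <= C1 * m ->
      (R0 <= D -> \sum_(y <- s) w y * (D' y - D) <= m * (C2 / D `^ alpha)) ->
      (level th r D tau < 1 -> forall y, 0 < w y ->
         ramp (level th r (D' y) tau) = 0) /\
      \sum_(y <- s) w y * (ramp (level th r (D' y) tau) - ramp (level th r D tau))
        <= c * m * r `^ (- (1 + alpha))].
Proof.
move=> th2 /andP[al0 al1] R00 j0 C10 C20.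
have th0 : 0 <= th by lra.
(* A / r bounds the variation of the level, B the second-order coefficient of
   level_sub_le, and E collects the first-order terms for R0 <= D and D < R0. *)
pose A : R := th * 3 `^ (th - 1) * j.
have A0 : 0 <= A by rewrite !mulr_ge0 ?powR_ge0.
pose B : R := th * (th - 1) * 3 `^ (th - 2) * j ^+ 2.
have B0 : 0 <= B by rewrite !mulr_ge0 ?powR_ge0 ?exprn_ge0//; lra.
pose E : R := th * C2 * 2 `^ (th - 1 - alpha) + th * R0 `^ (th - 1) * j * C1.
have E0 : 0 <= E by rewrite addr_ge0// !mulr_ge0 ?powR_ge0.
(* The radius 1 + j + 2 * A makes the variation A / r at most 1 / 2. *)
exists (6 * (E + B * C1) + 16 * A ^+ 2 * C1), (1 + j + 2 * A).
split; [|lra|].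
  by rewrite addr_ge0 ?mulr_ge0 ?exprn_ge0// addr_ge0// mulr_ge0.
move=> V s w D' m D tau r r1r m0 D0 tau0 z2 w0 D'0 DD' wm wD.
have r0 : 0 < r by lra.
have dz y : 0 < w y ->
    `|level th r (D' y) tau - level th r D tau| <= A / r.
  by move=> wy; apply: level_dist_le => //; [lra|lra|exact: DD'].
have Ar : A / r <= 1 / 2 by rewrite ler_pdivrMr//; lra.
split.
  move=> z1 y /dz; rewrite ler_norml => /andP[_ h].
  by apply: ramp0; lra.
pose P := pos_pow 2 (2 * level th r D tau - 3).
have P01 : 0 <= P <= 1 by rewrite pos_pow_ge0 pos_pow_le1//; lra.
have step1 y : w y * (ramp (level th r (D' y) tau) - ramp (level th r D tau))
   <= 6 * P * (w y * (level th r (D' y) tau - level th r D tau))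
      + w y * (16 * A ^+ 2 * r `^ (- 2)).
  have [->|wy] := eqVneq (w y) 0; first by rewrite !mul0r mulr0 addr0.
  have {}wy : 0 < w y by rewrite lt_neqAle eq_sym wy w0.
  rewrite (_ : 6 * P * _ = w y *
    (6 * P * (level th r (D' y) tau - level th r D tau))); last by ring.
  rewrite -mulrDr ler_wpM2l//.
  rewrite (le_trans (ramp_sub_le z2 (le_trans (dz _ wy) Ar)))// lerD2l.
  rewrite -mulrA ler_wpM2l// powR_invn ?(ltW r0)//.
  rewrite -exprVn -exprMn -(real_normK (num_real (level _ _ _ _ - _))).
  by rewrite lerXn2r// ?nnegrE ?divr_ge0 ?(ltW r0)//; exact: dz.
have step2 y : w y * (level th r (D' y) tau - level th r D tau) <=
    th * D `^ (th - 1) / r `^ th * (w y * (D' y - D)) + w y * (B * r `^ (- 2)).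
  have [->|wy] := eqVneq (w y) 0; first by rewrite !mul0r mulr0 addr0.
  have {}wy : 0 < w y by rewrite lt_neqAle eq_sym wy w0.
  rewrite (_ : th * _ / _ * _ =
    w y * (th * (D `^ (th - 1) * (D' y - D)) / r `^ th)); last by ring.
  rewrite -mulrDr ler_wpM2l//.
  by apply: level_sub_le => //; [lra|exact: DD'].
have r2 : r `^ (- 2) <= r `^ (- (1 + alpha)) by apply: powR_le_alpha; lra.
have step3 : th * D `^ (th - 1) / r `^ th * (\sum_(y <- s) w y * (D' y - D))
    <= E * m * r `^ (- (1 + alpha)).
  have [D_ge|D_lt] := leP R0 D.
    have k0 : 0 <= th * D `^ (th - 1) / r `^ th.
      by rewrite !mulr_ge0 ?invr_ge0 ?powR_ge0.
    apply: (le_trans (ler_wpM2l k0 (wD D_ge))).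
    have h1 : D `^ (th - 1) / D `^ alpha <= (2 * r) `^ (th - 1 - alpha).
      have [->|Dn0] := eqVneq D 0.
        by rewrite powR0 ?mul0r ?powR_ge0//; apply/eqP; lra.
      rewrite -powRB ?Dn0 ?implybT//.
      rewrite ge0_ler_powR ?nnegrE//; [lra|lra|].
      by apply: (@level_le2_le th _ _ tau) => //; lra.
    have h2 : (2 * r) `^ (th - 1 - alpha) / r `^ th =
        2 `^ (th - 1 - alpha) * r `^ (- (1 + alpha)).
      by rewrite powRM_div//; congr (_ * _ `^ _); ring.
    have -> : th * D `^ (th - 1) / r `^ th * (m * (C2 / D `^ alpha)) =
      (th * C2 * m / r `^ th) * (D `^ (th - 1) / D `^ alpha) by ring.
    have k1 : 0 <= th * C2 * m / r `^ th.
      by rewrite !mulr_ge0 ?invr_ge0 ?powR_ge0.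
    apply: (le_trans (ler_wpM2l k1 h1)).
    have -> : th * C2 * m / r `^ th * (2 * r) `^ (th - 1 - alpha) =
      th * C2 * m * ((2 * r) `^ (th - 1 - alpha) / r `^ th) by ring.
    rewrite h2 [in leRHS]/E !mulrDl.
    have -> : th * C2 * m * (2 `^ (th - 1 - alpha) * r `^ (- (1 + alpha))) =
      th * C2 * 2 `^ (th - 1 - alpha) * m * r `^ (- (1 + alpha)) by ring.
    by rewrite lerDl !mulr_ge0 ?powR_ge0.
  have h0 : \sum_(y <- s) w y * (D' y - D) <= j * (C1 * m).
    apply: (@le_trans _ _ (j * \sum_(y <- s) w y)); last by rewrite ler_wpM2l.
    rewrite mulr_sumr; apply: ler_sum => y _.
    have [->|wy] := eqVneq (w y) 0; first by rewrite mul0r mulr0.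
    have {}wy : 0 < w y by rewrite lt_neqAle eq_sym wy w0.
    by rewrite mulrC ler_wpM2r// (le_trans (ler_norm _))// DD'.
  have k0 : 0 <= th * D `^ (th - 1) / r `^ th.
    by rewrite !mulr_ge0 ?invr_ge0 ?powR_ge0.
  apply: (le_trans (ler_wpM2l k0 h0)).
  have h1 : D `^ (th - 1) <= R0 `^ (th - 1).
    by rewrite ge0_ler_powR ?nnegrE//; lra.
  have h2 : (r `^ th)^-1 <= r `^ (- (1 + alpha)).
    by rewrite -powRN; apply: powR_le_alpha; lra.
  apply: (@le_trans _ _ (th * R0 `^ (th - 1) * j * C1 * m * r `^ (- (1 + alpha)))).
    have -> : th * D `^ (th - 1) / r `^ th * (j * (C1 * m)) =
      th * j * C1 * m * (D `^ (th - 1) * (r `^ th)^-1) by ring.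
    have -> : th * R0 `^ (th - 1) * j * C1 * m * r `^ (- (1 + alpha)) =
      th * j * C1 * m * (R0 `^ (th - 1) * r `^ (- (1 + alpha))) by ring.
    rewrite ler_wpM2l ?mulr_ge0//.
    by rewrite ler_pM// ?invr_ge0 powR_ge0.
  by rewrite [in leRHS]/E !mulrDl lerDr !mulr_ge0 ?powR_ge0.
apply: (le_trans (ler_sum _ (fun y _ => step1 y))).
rewrite big_split/= -mulr_sumr -mulr_suml.
have step4 : \sum_(y <- s) w y * (level th r (D' y) tau - level th r D tau) <=
    (E + B * C1) * m * r `^ (- (1 + alpha)).
  apply: (le_trans (ler_sum _ (fun y _ => step2 y))).
  rewrite big_split/= -mulr_sumr -mulr_suml (mulrDl E) (mulrDl (E * m)) lerD//.
  have k : 0 <= B * r `^ (- 2) by rewrite mulr_ge0// powR_ge0.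
  apply: (le_trans (ler_wpM2r k wm)).
  have -> : C1 * m * (B * r `^ (- 2)) = (B * C1 * m) * r `^ (- 2) by ring.
  by rewrite ler_wpM2l// mulr_ge0// mulr_ge0.
have F0 : 0 <= (E + B * C1) * m * r `^ (- (1 + alpha)).
  by rewrite mulr_ge0 ?powR_ge0// mulr_ge0// addr_ge0// mulr_ge0.
have -> : (6 * (E + B * C1) + 16 * A ^+ 2 * C1) * m * r `^ (- (1 + alpha)) =
  6 * ((E + B * C1) * m * r `^ (- (1 + alpha))) +
  (16 * A ^+ 2 * C1 * m) * r `^ (- (1 + alpha)) by ring.
have [P0 P1] := andP P01.
rewrite lerD//.
  apply: (@le_trans _ _ (6 * P * ((E + B * C1) * m * r `^ (- (1 + alpha))))).
    by rewrite ler_wpM2l// mulr_ge0.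
  by rewrite -[leLHS]mulrA ler_wpM2l// ler_piMl.
have A2 : 0 <= 16 * A ^+ 2 by rewrite mulr_ge0// exprn_ge0.
have k : 0 <= 16 * A ^+ 2 * r `^ (- 2) by rewrite mulr_ge0// powR_ge0.
apply: (le_trans (ler_wpM2r k wm)).
have -> : C1 * m * (16 * A ^+ 2 * r `^ (- 2)) = (16 * A ^+ 2 * C1 * m) * r `^ (- 2).
  by ring.
by rewrite ler_wpM2l// mulr_ge0// mulr_ge0.
Qed.

(** Below level [2] the time satisfies [t `^ th2 <= 2 * r `^ th1], so every second
    time derivative is of order [r `^ (- 2 * th1 / th2)]; the hypothesis on the ratio
    says exactly that this is at most of order [r `^ (- (1 + alpha))]. *)
Lemma powR_time_le th1 th2 alpha t r : 2 <= th2 -> (1 + alpha) / 2 <= th1 / th2 ->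
  0 <= t -> 1 <= r -> t `^ th2 <= 2 * r `^ th1 ->
  t `^ (th2 - 2) / r `^ th1 <= 2 * r `^ (- (1 + alpha)) /\
  (t `^ (th2 - 1) / r `^ th1) ^+ 2 <= 4 * r `^ (- (1 + alpha)).
Proof.
move=> th22 ratio t0 r1 tr.
have r0 : 0 < r by lra.
have th20 : 0 < th2 by lra.
have q0 : 0 <= 1 - 2 / th2 by rewrite subr_ge0 ler_pdivrMr//; lra.
have q1 : 1 - 2 / th2 <= 1 by rewrite lerBlDr lerDl divr_ge0//; lra.
have first : t `^ (th2 - 2) / r `^ th1 <= 2 * r `^ (- (1 + alpha)).
  have -> : th2 - 2 = th2 * (1 - 2 / th2) by field; lra.
  rewrite powRrM ler_pdivrMr ?powR_gt0//.
  apply: (@le_trans _ _ ((2 * r `^ th1) `^ (1 - 2 / th2))).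
    by rewrite ge0_ler_powR ?nnegrE ?mulr_ge0 ?powR_ge0.
  rewrite powRM ?powR_ge0// -mulrA ler_pM ?powR_ge0//.
    by rewrite -[leRHS]powRr1// ler_powR//; lra.
  rewrite -powRrM -powRD; last by rewrite (gt_eqF r0) implybT.
  rewrite ler_powR//.
  have -> : th1 * (1 - 2 / th2) = th1 - 2 * (th1 / th2) by field; lra.
  by lra.
split => //.
have [t00|tn0] := eqVneq t 0.
  rewrite t00 powR0; last by apply/eqP; lra.
  by rewrite mul0r expr0n/= mulr_ge0 ?powR_ge0.
have -> : (t `^ (th2 - 1) / r `^ th1) ^+ 2 =
  (t `^ th2 / r `^ th1) * (t `^ (th2 - 2) / r `^ th1).
  have e : (t `^ (th2 - 1)) ^+ 2 = t `^ th2 * t `^ (th2 - 2).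
    rewrite expr2 -!powRD ?tn0 ?implybT//.
    by congr (_ `^ _); ring.
  by rewrite exprMn e exprVn expr2 invfM; ring.
rewrite (_ : 4 = 2 * 2 :> R); last by ring.
rewrite -[leRHS]mulrA ler_pM// ?divr_ge0 ?powR_ge0//.
by rewrite ler_pdivrMr// powR_gt0.
Qed.

End level.

(** * The cutoff along the level function *)

Section profile.
Context {R : realType}.
Implicit Types (alpha D r t : R).

(** The cutoff at a vertex at distance [D] from the centre, as a function of time.
    [profile1] and [profile2] are its first and second time derivatives. *)
Definition profile n (th1 th2 : R) r D t : R := cutoff n (level th1 r D (t `^ th2)).

Definition profile1 n (th1 th2 : R) r D t : R :=
  cutoff1 n (level th1 r D (t `^ th2)) * (th2 / r `^ th1 * t `^ (th2 - 1)).

Definition profile2 n (th1 th2 : R) r D t : R :=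
  cutoff2 n (level th1 r D (t `^ th2)) * (th2 / r `^ th1 * t `^ (th2 - 1)) ^+ 2
  + cutoff1 n (level th1 r D (t `^ th2)) *
    (th2 * (th2 - 1) / r `^ th1 * t `^ (th2 - 2)).

Lemma ray_has_derive_level (th1 th2 : R) r D t : 0 <= t -> 1 <= th2 ->
  ray_has_derive (fun s => level th1 r D (s `^ th2)) t
    (th2 / r `^ th1 * t `^ (th2 - 1)).
Proof.
move=> t0 th21.
have := @ray_has_derive_affine R _ (D `^ th1 / r `^ th1) (r `^ th1)^-1 _ _
  (ray_has_derive_powR t0 th21).
rewrite (_ : _ * (_ * _) = th2 / r `^ th1 * t `^ (th2 - 1)); last by ring.
by apply: ray_has_derive_eq => // s _; rewrite /level; ring.
Qed.

Lemma ray_has_derive_profile n (th1 th2 : R) r D t : 0 <= t -> 1 <= th2 ->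
  ray_has_derive (profile n.+2 th1 th2 r D) t (profile1 n.+2 th1 th2 r D t).
Proof.
move=> t0 th21.
have h := @ray_has_derive_comp R _ (cutoff n.+2) t _ _
  (@ray_has_derive_level th1 th2 r D t t0 th21) (is_derive_cutoff n _).
exact h.
Qed.

Lemma ray_has_derive_profile1 n (th1 th2 : R) r D t : 0 <= t -> 2 <= th2 ->
  ray_has_derive (profile1 n.+3 th1 th2 r D) t (profile2 n.+3 th1 th2 r D t).
Proof.
move=> t0 th22; have th21 : 1 <= th2 by lra.
have h := @ray_has_derive_comp R _ (cutoff1 n.+3) t _ _
  (@ray_has_derive_level th1 th2 r D t t0 th21) (is_derive_cutoff1 n _).
have k := @ray_has_derive_affine R _ 0 (th2 / r `^ th1) _ _
  (ray_has_derive_powR t0 (_ : 1 <= th2 - 1)).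
have {}k := k ltac:(lra).
have := ray_has_deriveM h k.
rewrite [X in ray_has_derive _ _ X](_ : _ = profile2 n.+3 th1 th2 r D t); last first.
  rewrite (_ : th2 - 1 - 1 = th2 - 2) /profile2/=; last by ring.
  by rewrite add0r; ring.
by apply: ray_has_derive_eq => // s _; rewrite /profile1/= add0r.
Qed.

Lemma continuous_powR_ray (p : R) : 0 <= p ->
  {within `[0, +oo[, continuous (fun s : R => s `^ p)}.
Proof.
rewrite le_eqVlt => /predU1P[<-|p0].
  rewrite (_ : (fun s : R => _) = cst 1); last by apply/funext => s; rewrite powRr0.
  by apply: continuous_subspaceT => x; exact: cvg_cst.
apply/continuous_within_itvcyP; split.
  move=> x; rewrite in_itv/= andbT => x0.
  apply: differentiable_continuous; apply/derivable1_diffP.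
  by apply: derivable_powR; rewrite in_itv/= andbT.
by rewrite powR0 ?gt_eqF//; exact: powR_cvg0.
Qed.

Lemma continuous_level_ray (th1 th2 : R) r D : 0 <= th2 ->
  {within `[0, +oo[, continuous (fun t : R => level th1 r D (t `^ th2))}.
Proof.
move=> th20; rewrite /level => t; apply: cvgM; last exact: cvg_cst.
by apply: cvgD; [exact: cvg_cst|exact: continuous_powR_ray].
Qed.

Lemma continuous_profile2 n (th1 th2 : R) r D : 2 <= th2 ->
  {within `[0, +oo[, continuous (profile2 n.+3 th1 th2 r D)}.
Proof.
move=> th22.
have cl := @continuous_level_ray th1 th2 r D ltac:(lra).
have cp p : 0 <= p -> forall c : R,
    {within `[0, +oo[, continuous (fun t : R => c * t `^ p)}.
  move=> p0 c t; apply: cvgM; first exact: cvg_cst.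
  exact: continuous_powR_ray.
have comp (f g : R -> R) : {within `[0, +oo[, continuous f} -> continuous g ->
    {within `[0, +oo[, continuous (g \o f)}.
  by move=> cf cg; apply: within_continuous_comp => // z _; exact: cg.
have c2 := comp _ _ cl (@continuous_cutoff2 R n.+3).
have c1 : {within `[0, +oo[, continuous
    (cutoff1 n.+3 \o (fun t : R => level th1 r D (t `^ th2)))}.
  apply: comp cl _ => z; apply: differentiable_continuous; apply/derivable1_diffP.
  exact: (@ex_derive _ _ _ _ _ _ _ (is_derive_cutoff1 n _)).
have c3 := comp _ _ (cp (th2 - 1) ltac:(lra) (th2 / r `^ th1))
  (@exprn_continuous R 2).
have c4 := cp (th2 - 2) ltac:(lra) (th2 * (th2 - 1) / r `^ th1).
move=> t; apply: cvgD; apply: cvgM; [exact: c2|exact: c3|exact: c1|exact: c4].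
Qed.

Lemma ray_derive_profile n (th1 th2 : R) r D t : 0 <= t -> 2 <= th2 ->
  ray_derive (profile n.+3 th1 th2 r D) t = profile1 n.+3 th1 th2 r D t.
Proof.
by move=> t0 th22; apply: (ray_deriveP t0 (@ray_has_derive_profile _ th1 th2 r D t t0 _)).2; lra.
Qed.

Lemma ray_has_derive_profile_derive n (th1 th2 : R) r D t : 0 <= t -> 2 <= th2 ->
  ray_has_derive (ray_derive (profile n.+3 th1 th2 r D)) t
    (profile2 n.+3 th1 th2 r D t).
Proof.
move=> t0 th22.
apply: ray_has_derive_eq (@ray_has_derive_profile1 n th1 th2 r D t t0 th22) => // s s0.
by rewrite ray_derive_profile.
Qed.

Lemma ray_derive2_profile n (th1 th2 : R) r D t : 0 <= t -> 2 <= th2 ->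
  ray_derive (ray_derive (profile n.+3 th1 th2 r D)) t = profile2 n.+3 th1 th2 r D t.
Proof. by move=> t0 th22; apply: (ray_deriveP t0 (@ray_has_derive_profile_derive n th1 th2 r D t t0 _)).2. Qed.

Lemma C2_ray_profile n (th1 th2 : R) r D : 2 <= th2 -> C2_ray (profile n.+3 th1 th2 r D).
Proof.
move=> th22; split.
- move=> t t0; apply: (ray_deriveP t0 (@ray_has_derive_profile _ th1 th2 r D t t0 _)).1; lra.
- by move=> t t0; apply: (ray_deriveP t0 (@ray_has_derive_profile_derive n th1 th2 r D t t0 _)).1.
- apply: (@subspace_eq_continuous _ _ _ (profile2 n.+3 th1 th2 r D)); last exact: continuous_profile2.
  move=> t.
  by rewrite inE/= in_itv/= andbT => t0; rewrite /from_subspace/= ray_derive2_profile.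
Qed.

Lemma profile01 n (th1 th2 : R) r D t : 0 <= profile n th1 th2 r D t <= 1.
Proof. exact: cutoff01. Qed.

(** Since [1 < th2], the test function is stationary at the initial time, which
    removes [u0] from the weak formulation. *)
Lemma profile1_t0 n (th1 th2 : R) r D : 2 <= th2 -> profile1 n th1 th2 r D 0 = 0.
Proof. by move=> th22; rewrite /profile1 [0 `^ (_ - _)]powR0 ?mulr0//; apply/eqP; lra. Qed.

Lemma level_ge (th1 r D D0 tau : R) : 0 <= tau -> 0 <= D0 -> 0 <= th1 -> 0 < r ->
  D0 <= D -> (D0 / r) `^ th1 <= level th1 r D tau.
Proof.
move=> tau0 D00 th10 r0 DD; rewrite /level.
rewrite powRM// ?invr_ge0 ?(ltW r0)//.
rewrite (_ : r^-1 `^ th1 = (r `^ th1)^-1); last first.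
  by rewrite -(powR_inv1 (ltW r0)) -powRrM mulN1r powRN.
rewrite ler_wpM2r ?invr_ge0 ?powR_ge0//.
have : D0 `^ th1 <= D `^ th1 by rewrite ge0_ler_powR ?nnegrE// (le_trans D00).
lra.
Qed.

Lemma profile_eq1_init n (th1 th2 : R) r D : 0 <= th1 -> th2 != 0 -> 0 < r -> 0 <= D < r ->
  profile n th1 th2 r D 0 = 1.
Proof.
move=> th10 th20 r0 /andP[D0 Dr]; apply: cutoff_eq1; rewrite powR0// /level addr0.
rewrite ler_pdivrMr ?powR_gt0//.
have : D `^ th1 <= r `^ th1 by rewrite ge0_ler_powR ?nnegrE// ?(ltW Dr) ?(ltW r0).
have := powR_ge0 r th1; lra.
Qed.

Lemma profile_nondecr n (th1 th2 r r' : R) D t : 0 <= th1 -> 0 < r -> r <= r' ->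
  profile n th1 th2 r D t <= profile n th1 th2 r' D t.
Proof.
move=> th10 r0 rr'; apply: cutoff_nonincr; rewrite /level ler_wpM2l ?addr_ge0 ?powR_ge0//.
have r'0 := lt_le_trans r0 rr'.
by rewrite lef_pV2 ?posrE ?powR_gt0// ge0_ler_powR ?nnegrE// ltW.
Qed.

(** Doubling the radius divides the level by at least [4] and halving it multiplies
    the level by at least [4]. Hence on the annulus the increment of the cutoff
    between the radii [r / 2] and [2 * r] is [1]. *)
Lemma profile_annulus n (th1 th2 : R) r D t : 2 <= th1 -> 0 < r ->
  1 <= level th1 r D (t `^ th2) <= 2 ->
  profile n.+1 th1 th2 (2 * r) D t = 1 /\ profile n.+1 th1 th2 (r / 2) D t = 0.
Proof.
move=> th12 r0 /andP[z1 z2].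
have e k : 0 < k -> level th1 (k * r) D (t `^ th2) =
    level th1 r D (t `^ th2) / k `^ th1.
  move=> k0; rewrite /level powRM ?(ltW k0) ?(ltW r0)//.
  by rewrite invfM mulrCA mulrC mulrAC.
have k4 : 2 `^ 2 <= 2 `^ th1 :> R by rewrite ler_powR//; lra.
have k2 : (2 : R) `^ 2 = 4 by rewrite powR_mulrn//; ring.
split.
  apply: cutoff_eq1; rewrite e// ler_pdivrMr ?powR_gt0//; lra.
apply: cutoff_eq0; rewrite mulrC e ?invr_gt0//.
rewrite -(powR_inv1 (ler0n _ 2)) -powRrM mulN1r powRN invrK.
nra.
Qed.

End profile.

(** * Pointwise bound for the wave operator *)

Section pointwise.
Context {R : realType}.
Implicit Types (alpha D r t : R).

(** Convexity of the power [n.+2] reduces the increment of the cutoff to that of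
    [plateau], which is at most the opposite increment of [ramp]: the truncation at
    [0] only raises [plateau y], and when it acts at [x] the factor [plateau x]
    vanishes. *)
Lemma cutoff_sub_le n (x y : R) :
  cutoff n.+2 x - cutoff n.+2 y <=
  n.+2%:R * plateau x ^+ n.+1 * (ramp y - ramp x).
Proof.
have [gx|gx] := eqVneq (plateau x) 0.
  rewrite !cutoffE gx !expr0n sub0r mulr0 mul0r oppr_le0.
  by rewrite exprn_ge0//; have /andP[] := plateau01 y.
have /andP[g0 _] := plateau01 x; have /andP[h0 _] := plateau01 y.
have gE : plateau x = 1 - ramp x.
  have [h|h] := leP (ramp x) 1; first by rewrite /plateau pos_powT ?expr1; lra.
  by move: gx; rewrite /plateau pos_powF ?eqxx//; lra.
have hE : 1 - ramp y <= plateau y.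
  have [h|h] := leP (ramp y) 1; first by rewrite /plateau pos_powT ?expr1; lra.
  by lra.
rewrite !cutoffE.
have := exprn_tangent n.+1 g0 h0.
have : n.+2%:R * plateau x ^+ n.+1 * (ramp x - ramp y) <=
    n.+2%:R * plateau x ^+ n.+1 * (plateau y - plateau x).
  by rewrite ler_wpM2l ?mulr_ge0 ?exprn_ge0//; lra.
lra.
Qed.

Lemma profile2_le n (th1 th2 : R) alpha D r t :
  2 <= th2 -> (1 + alpha) / 2 <= th1 / th2 -> 0 <= t -> 1 <= r ->
  level th1 r D (t `^ th2) <= 2 ->
  profile2 n.+3 th1 th2 r D t <=
  (240 * n.+3%:R ^+ 2 * th2 ^+ 2 + 12 * n.+3%:R * (th2 * (th2 - 1))) *
    plateau (level th1 r D (t `^ th2)) ^+ n.+1 * r `^ (- (1 + alpha)).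
Proof.
move=> th22 ratio t0 r1 z2.
have tr : t `^ th2 <= 2 * r `^ th1.
  move: z2; rewrite /level ler_pdivrMr ?powR_gt0//; last lra.
  by have := powR_ge0 D th1; lra.
have [T1 T2] := powR_time_le th22 ratio t0 r1 tr.
have [c1 c2] := @cutoff12_le R n (level th1 r D (t `^ th2)).
have /andP[g0 _] := plateau01 (level th1 r D (t `^ th2)).
have G0 := @exprn_ge0 R n.+1 _ g0.
rewrite /profile2.
move: c1 c2 G0; set G := plateau _ ^+ _; set C1 := cutoff1 _ _; set C2 := cutoff2 _ _.
move=> c1 c2 G0.
set N := n.+3%:R in c1 c2 *.
have N0 : 0 <= N by rewrite ler0n.
move: T1 T2; set ra := r `^ (- _); set U := _ / r `^ th1; set W := _ / r `^ th1 => T1 T2.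
have ra0 : 0 <= ra by exact: powR_ge0.
have U0 : 0 <= U by rewrite divr_ge0 ?powR_ge0.
have -> : th2 / r `^ th1 * t `^ (th2 - 1) = th2 * W by rewrite /W; ring.
have -> : th2 * (th2 - 1) / r `^ th1 * t `^ (th2 - 2) = th2 * (th2 - 1) * U.
  by rewrite /U; ring.
have A1 : C2 * (th2 * W) ^+ 2 <= (60 * N ^+ 2 * G) * (th2 ^+ 2 * (4 * ra)).
  rewrite exprMn.
  apply: (@le_trans _ _ ((60 * N ^+ 2 * G) * (th2 ^+ 2 * W ^+ 2))).
    apply: ler_wpM2r; first exact: mulr_ge0 (sqr_ge0 _) (sqr_ge0 _).
    exact: le_trans (ler_norm _) c2.
  rewrite ler_wpM2l//; first by rewrite mulr_ge0// mulr_ge0// exprn_ge0.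
  apply: ler_wpM2l; first exact: sqr_ge0.
  exact: T2.
have A2 : C1 * (th2 * (th2 - 1) * U) <= (6 * N * G) * (th2 * (th2 - 1) * (2 * ra)).
  have q : 0 <= th2 * (th2 - 1) by rewrite mulr_ge0//; lra.
  apply: (@le_trans _ _ ((6 * N * G) * (th2 * (th2 - 1) * U))).
    by apply: ler_wpM2r; [exact: mulr_ge0|exact: le_trans (ler_norm _) c1].
  apply: ler_wpM2l; first by rewrite mulr_ge0// mulr_ge0.
  by apply: ler_wpM2l; [exact: q|exact: T1].
rewrite -/ra; lra.
Qed.

Definition in_level (th1 th2 : R) r D t : bool :=
  1 <= level th1 r D (t `^ th2) <= 2.

(** The left-hand side is [m] times the wave operator applied to the cutoff. It is
    nonpositive off the annulus: above level [2] the cutoff vanishes at the vertex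
    and is nonnegative at its neighbours, and below level [1] it equals [1] there and
    at the neighbours. On the annulus, time and space derivatives have the same order
    [r `^ (- (1 + alpha))] and leave the power [n.+1] of [plateau]. *)
Lemma profile2_laplacian_le n (th1 th2 alpha R0 j C1 C2 : R) :
  2 <= th1 -> 2 <= th2 -> (1 + alpha) / 2 <= th1 / th2 ->
  0 <= alpha <= 1 -> 0 <= R0 -> 0 <= j -> 0 <= C1 -> 0 <= C2 ->
  exists c r1 : R, [/\ 0 < c, 1 <= r1 &
    forall (V : Type) (s : seq V) (w D' : V -> R) (m D t r : R),
      r1 <= r -> 0 <= m -> 0 <= D -> 0 <= t ->
      (forall y, 0 <= w y) -> (forall y, 0 <= D' y) ->
      (forall y, 0 < w y -> `|D' y - D| <= j) ->
      \sum_(y <- s) w y <= C1 * m ->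
      (R0 <= D -> \sum_(y <- s) w y * (D' y - D) <= m * (C2 / D `^ alpha)) ->
      m * profile2 n.+3 th1 th2 r D t -
        \sum_(y <- s) w y *
          (profile n.+3 th1 th2 r (D' y) t - profile n.+3 th1 th2 r D t) <=
      m * (c * r `^ (- (1 + alpha)) *
        plateau (level th1 r D (t `^ th2)) ^+ n.+1 * (in_level th1 th2 r D t)%:R)].
Proof.
move=> th12 th22 ratio al R00 j0 C10 C20.
have [c [r1 [c0 r11 H]]] := sum_ramp_level_le th12 al R00 j0 C10 C20.
pose K : R := 240 * n.+3%:R ^+ 2 * th2 ^+ 2 + 12 * n.+3%:R * (th2 * (th2 - 1)).
have K0 : 0 <= K.
  by rewrite addr_ge0 ?mulr_ge0 ?exprn_ge0//; lra.
exists (1 + K + n.+3%:R * c), r1; split => //.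
  by rewrite -addrA ltr_pwDl// addr_ge0// mulr_ge0.
move=> V s w D' m D t r r1r m0 D0 t0 w0 D'0 DD' wm wD.
have {}H := H V s w D' m D (t `^ th2) r r1r m0 D0 (powR_ge0 _ _) _ w0 D'0 DD' wm wD.
rewrite /in_level.
set L := level th1 r D (t `^ th2) in H *.
have [L2|L2] := ltP 2 L.
  rewrite andbF mulr0 mulr0 subr_le0 /profile2 -/L.
  have [-> ->] := @cutoff12_eq0 R n L ltac:(by rewrite L2 orbT).
  rewrite !mul0r addr0 mulr0 sumr_ge0// => y _.
  rewrite mulr_ge0// {2}/profile -/L cutoff_eq0 ?(ltW L2)// subr0.
  by have /andP[] := profile01 n.+3 th1 th2 r (D' y) t.
have {H}[H1 H2] := H L2.
have [L1|L1] := ltP L 1.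
  rewrite /= mulr0 mulr0 subr_le0 /profile2 -/L.
  have [-> ->] := @cutoff12_eq0 R n L ltac:(by rewrite L1).
  rewrite !mul0r addr0 mulr0 big1// => y _.
  have [->|wy] := eqVneq (w y) 0; first by rewrite mul0r.
  have {}wy : 0 < w y by rewrite lt_neqAle eq_sym wy w0.
  rewrite /profile -/L (@cutoff_eq1 _ _ L); last lra.
  rewrite /cutoff (H1 L1 y wy) subr0 pos_powT// expr1n subrr mulr0//.
rewrite /= mulr1.
have B := profile2_le n th22 ratio t0 (le_trans r11 r1r) L2.
rewrite -/L -/K in B.
have /andP[g0 g1] := plateau01 L.
have S : - \sum_(y <- s) w y * (profile n.+3 th1 th2 r (D' y) t - profile n.+3 th1 th2 r D t)
   <= n.+3%:R * plateau L ^+ n.+2 * (c * m * r `^ (- (1 + alpha))).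
  apply: (@le_trans _ _ (n.+3%:R * plateau L ^+ n.+2 *
     \sum_(y <- s) w y * (ramp (level th1 r (D' y) (t `^ th2)) - ramp L))); last first.
    by rewrite ler_wpM2l// mulr_ge0// exprn_ge0.
  rewrite mulr_sumr -sumrN; apply: ler_sum => y _.
  rewrite mulrCA -mulrN ler_wpM2l// opprB.
  exact: cutoff_sub_le.
apply: (le_trans (lerD (ler_wpM2l m0 B) S)).
have ra0 := powR_ge0 r (- (1 + alpha)).
move: ra0; set ra := r `^ _ => ra0.
have g2 : plateau L ^+ n.+2 <= plateau L ^+ n.+1.
  by rewrite exprS ler_piMl// exprn_ge0.
have G0 : 0 <= plateau L ^+ n.+1 by exact: exprn_ge0.
have -> : m * ((1 + K + n.+3%:R * c) * ra * plateau L ^+ n.+1) =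
  m * (K * plateau L ^+ n.+1 * ra) + n.+3%:R * plateau L ^+ n.+1 * (c * m * ra)
  + m * ra * plateau L ^+ n.+1 by ring.
rewrite -[leLHS]addr0 lerD//; last by rewrite mulr_ge0// mulr_ge0.
rewrite lerD2l ler_wpM2r//; first by rewrite mulr_ge0// mulr_ge0.
by rewrite ler_wpM2l.
Qed.

(** Young's inequality in elementary form: either [c <= K * v * a `^ (sigma - 1) *
    g ^+ 2], and the first term dominates, or [a] is smaller than the power [p] of
    the remaining quotient, and the second term dominates. The hypothesis
    [2 * p <= n%:R] lets [g ^+ n] absorb the negative power [g ^- 2] raised to [p]. *)
Lemma young_cutoff n (sigma p c K v a g : R) :
  1 < sigma -> p = (sigma - 1)^-1 -> 2 * p <= n%:R -> 0 < c -> 0 < K -> 0 < v ->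
  0 <= a -> 0 <= g <= 1 ->
  a * (c * g ^+ n) <=
  K * (v * a `^ sigma * g ^+ n.+2) + c `^ (1 + p) * K `^ (- p) * v `^ (- p).
Proof.
move=> s1 pE pn c0 K0 v0 a0 /andP[g0 g1].
have p0 : 0 < p by rewrite pE invr_gt0; lra.
have [g00|gn0] := eqVneq g 0.
  rewrite g00; have n0 : n != 0%N.
    by apply/eqP => n0; move: pn; rewrite n0; lra.
  rewrite expr0n (negbTE n0) mulr0 mulr0.
  apply: addr_ge0; last by rewrite mulr_ge0 ?powR_ge0// mulr_ge0 ?powR_ge0.
  by rewrite mulr_ge0 ?(ltW K0)// mulr_ge0 ?exprn_ge0// mulr_ge0 ?powR_ge0// ltW.
have {}g0 : 0 < g by rewrite lt_neqAle eq_sym gn0.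
have aE : a `^ sigma = a * a `^ (sigma - 1) by rewrite mulr_powRB1//; lra.
have [h|h] := leP c (K * v * a `^ (sigma - 1) * g ^+ 2).
  apply: (@le_trans _ _ (K * (v * a `^ sigma * g ^+ n.+2))); last first.
    by rewrite lerDl !mulr_ge0 ?powR_ge0.
  rewrite aE.
  have -> : K * (v * (a * a `^ (sigma - 1)) * g ^+ n.+2) =
    a * ((K * v * a `^ (sigma - 1) * g ^+ 2) * g ^+ n).
    by rewrite -addn2 exprD; ring.
  by rewrite ler_wpM2l// ler_wpM2r// exprn_ge0// ltW.
have Kv : 0 < K * v * g ^+ 2 by rewrite !mulr_gt0 ?exprn_gt0.
have h1 : a `^ (sigma - 1) <= c / (K * v * g ^+ 2).
  by rewrite ler_pdivlMr//; nra.
have h2 : a <= (c / (K * v * g ^+ 2)) `^ p.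
  have -> : a = (a `^ (sigma - 1)) `^ p.
    by rewrite -powRrM pE mulfV ?powRr1//; apply/eqP; lra.
  by rewrite ge0_ler_powR ?nnegrE ?powR_ge0 ?(ltW p0)// divr_ge0 ?ltW.
apply: (@le_trans _ _ (c `^ (1 + p) * K `^ (- p) * v `^ (- p))); last first.
  by rewrite lerDr mulr_ge0 ?(ltW K0)// mulr_ge0 ?exprn_ge0 ?(ltW g0)// mulr_ge0 ?powR_ge0// ltW.
have G : g ^+ n <= (g ^+ 2) `^ p.
  rewrite -(powR_mulrn n (ltW g0)) -(powR_mulrn 2 (ltW g0)) -powRrM.
  by apply: ger_powR => //; rewrite g0.
apply: (@le_trans _ _ ((c / (K * v * g ^+ 2)) `^ p * (c * (g ^+ 2) `^ p))).
  rewrite ler_pM ?mulr_ge0 ?exprn_ge0 ?(ltW c0) ?(ltW g0)//.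
  by rewrite ler_wpM2l// ltW.
have : 0 < g ^+ 2 by rewrite exprn_gt0.
move: (g ^+ 2) => q q0.
rewrite !invfM !powRM ?invr_ge0 ?mulr_ge0 ?invr_ge0 ?(ltW c0) ?(ltW K0)
  ?(ltW v0) ?(ltW q0)//.
have iE (z : R) : 0 < z -> z^-1 `^ p = z `^ (- p).
  by move=> z0; rewrite -(powR_inv1 (ltW z0)) -powRrM mulN1r.
rewrite !iE//.
rewrite powRD; last by rewrite (gt_eqF c0) implybT.
rewrite powRr1 ?(ltW c0)//.
rewrite (powRN q) le_eqVlt; apply/orP; left; apply/eqP; field.
by rewrite gt_eqF// powR_gt0.
Qed.

End pointwise.

(** * Lebesgue integration on the half-line *)

Section ray_integral.
Context {R : realType}.
Implicit Types (f g h : R -> R).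

Local Notation Leb := (caratheodory_type (mu_ext (@wlength R idfun))).
Local Notation ray := (`[0%R, +oo[%classic : set R).

Definition ray_integrable f : Prop :=
  leb.-integrable (ray : set Leb) (EFin \o f).

Definition ray_integral f : R := (\int[leb]_(t in ray) f t)%R.

Lemma borel_lebesgue_measurable (A : set R) :
  measurable (A : set (measurableTypeR R)) -> measurable (A : set Leb).
Proof. exact: sub_caratheodory. Qed.

Lemma measurable_ray : measurable (ray : set Leb).
Proof. by apply: borel_lebesgue_measurable; exact: measurable_itv. Qed.

Lemma borel_lebesgue_measurable_fun (D : set R) f :
  measurable (D : set (measurableTypeR R)) ->
  measurable_fun (D : set (measurableTypeR R)) f -> lebesgue_measurable_fun D f.
Proof.
move=> mD mf _ B mB; apply: borel_lebesgue_measurable.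
exact: (mf mD B mB).
Qed.

Lemma lebesgue_measurable_comp (D : set R) f g :
  measurable_fun setT g -> lebesgue_measurable_fun D f ->
  lebesgue_measurable_fun D (g \o f).
Proof. by move=> mg mf; exact: measurableT_comp. Qed.

Lemma lebesgue_measurable_mul (D : set R) f g :
  lebesgue_measurable_fun D f -> lebesgue_measurable_fun D g ->
  lebesgue_measurable_fun D (f \* g).
Proof. by move=> mf mg; exact: measurable_funM. Qed.

Lemma L1loc_cutoff_integrable f h (T M : R) : 0 < T -> L1loc_ray f ->
  lebesgue_measurable_fun ray h -> (forall t, 0 <= t -> `|h t| <= M) ->
  (forall t, T <= t -> h t = 0) ->
  ray_integrable (fun t => f t * h t).
Proof.
move=> T0 fL mh hM hT.
have mT : measurable (`[0, T]%classic : set Leb).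
  by apply: borel_lebesgue_measurable; exact: measurable_itv.
have sT : `[0, T] `<=` ray.
  by move=> t /=; rewrite !in_itv/= => /andP[->].
have i1 : leb.-integrable (`[0, T]%classic : set Leb) (EFin \o (fun t => f t * h t)).
  have := @integrableMl _ Leb R leb _ mT (EFin \o f) h (fL T T0) _ _.
  apply.
    exact: (measurable_funS measurable_ray sT mh).
  exists M; split; first exact: num_real.
  move=> x Mx t /=; rewrite in_itv/= => /andP[t0 _].
  exact: le_trans (hM t t0) (ltW Mx).
have := (integrable_mkcond (mu := leb) _ mT).1 i1.
move=> i2; apply/(integrable_mkcond (mu := leb) _ measurable_ray).2.
apply: eq_integrable i2 => // t _.
rewrite !patchE; case: ifPn => tT; case: ifPn => tr //=.
  by exfalso; move: tr; rewrite (_ : t \in ray)//; apply/mem_set/sT/set_mem.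
rewrite hT ?mulr0//.
move: tT tr; rewrite !(mem_setE, in_itv)/= andbT => h1 h2.
by move: h1; rewrite h2/= -ltNge => /ltW.
Qed.

Lemma ray_integrable_sum (V : Type) (s : seq V) (F : V -> R -> R) :
  (forall x, ray_integrable (F x)) ->
  ray_integrable (fun t => \sum_(x <- s) F x t).
Proof.
move=> Fi; rewrite /ray_integrable.
have := @integrable_sum _ Leb R leb _ measurable_ray _ s xpredT
  (fun x => EFin \o F x) (fun x _ => Fi x).
by apply: eq_integrable => [|t _]; [exact: measurable_ray|rewrite /= sumEFin].
Qed.

Lemma ray_integral_sum (V : Type) (s : seq V) (F : V -> R -> R) :
  (forall x, ray_integrable (F x)) ->
  ray_integral (fun t => \sum_(x <- s) F x t) = \sum_(x <- s) ray_integral (F x).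
Proof.
move=> Fi; elim: s => [|x s ih].
  rewrite big_nil /ray_integral; under eq_Rintegral do rewrite big_nil.
  by rewrite Rintegral_cst ?mul0r//; exact: measurable_ray.
rewrite big_cons -ih /ray_integral; under eq_Rintegral do rewrite big_cons.
rewrite RintegralD//; [exact: measurable_ray|exact: Fi|exact: ray_integrable_sum].
Qed.

Lemma ray_integrableZ (k : R) f : ray_integrable f -> ray_integrable (fun t => k * f t).
Proof.
by move=> fi; have := @integrableZl _ Leb R leb _ measurable_ray k _ fi.
Qed.

Lemma ray_integralZ (k : R) f : ray_integrable f ->
  ray_integral (fun t => k * f t) = k * ray_integral f.
Proof. by move=> fi; apply: RintegralZl => //; exact: measurable_ray. Qed.

Lemma ray_integrableD f g : ray_integrable f -> ray_integrable g ->
  ray_integrable (fun t => f t + g t).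
Proof.
by move=> fi gi; have := @integrableD _ Leb R leb _ measurable_ray _ _ fi gi.
Qed.

Lemma ray_integralD f g : ray_integrable f -> ray_integrable g ->
  ray_integral (fun t => f t + g t) = ray_integral f + ray_integral g.
Proof. by move=> fi gi; apply: RintegralD => //; exact: measurable_ray. Qed.

Lemma ray_integralB f g : ray_integrable f -> ray_integrable g ->
  ray_integral (fun t => f t - g t) = ray_integral f - ray_integral g.
Proof. by move=> fi gi; apply: RintegralB => //; exact: measurable_ray. Qed.

Lemma eq_ray_integral f g : (forall t, 0 <= t -> f t = g t) ->
  ray_integral f = ray_integral g.
Proof.
move=> fg; apply: eq_Rintegral => t; rewrite inE/= in_itv/= andbT; exact: fg.
Qed.

Lemma eq_ray_integrable f g : (forall t, 0 <= t -> f t = g t) ->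
  ray_integrable f -> ray_integrable g.
Proof.
move=> fg; apply: eq_integrable; first exact: measurable_ray.
by move=> t; rewrite inE/= in_itv/= andbT => t0; rewrite /= fg.
Qed.

Lemma le_ray_integral f g : ray_integrable f -> ray_integrable g ->
  (forall t, 0 <= t -> f t <= g t) -> ray_integral f <= ray_integral g.
Proof.
move=> fi gi fg; apply: le_Rintegral => //; first exact: measurable_ray.
by move=> t /=; rewrite in_itv/= andbT; exact: fg.
Qed.

Lemma ray_integral_ge0 f : (forall t, 0 <= t -> 0 <= f t) -> 0 <= ray_integral f.
Proof.
move=> f0; apply: Rintegral_ge0 => t /=; rewrite in_itv/= andbT; exact: f0.
Qed.

Lemma ae_leb_imp (P Q : R -> Prop) : (forall t, P t -> Q t) ->
  {ae leb, forall t : R, P t} -> {ae leb, forall t : R, Q t}.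
Proof.
move=> PQ; apply: (@filterS _ _ (ae_filter_ringOfSetsType
  [the {measure set _ -> \bar R} of leb])).
exact: PQ.
Qed.

Lemma ae_eq_ray_integral f g : ray_integrable f -> ray_integrable g ->
  {ae leb, forall t : R, 0 <= t -> f t = g t} -> ray_integral f = ray_integral g.
Proof.
move=> fi gi fg; congr fine; apply: ae_eq_integral.
- exact: measurable_ray.
- exact: measurable_int fi.
- exact: measurable_int gi.
- apply: ae_leb_imp fg => t tfg /=; rewrite in_itv/= andbT => t0; by rewrite tfg.
Qed.

Lemma ray_integral_eq0 f : ray_integrable f -> (forall t, 0 <= t -> 0 <= f t) ->
  ray_integral f <= 0 -> {ae leb, forall t : R, 0 <= t -> f t = 0}.
Proof.
move=> fi f0 I0.
have fE : EFin (ray_integral f) = (\int[leb]_(t in (ray : set Leb)) (f t)%:E)%E.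
  rewrite /ray_integral /Rintegral fineK//.
  exact: (integrable_fin_num measurable_ray fi).
have I00 : ray_integral f = 0 by apply/eqP; rewrite eq_le I0 ray_integral_ge0.
have aI0 : (\int[leb]_(t in (ray : set Leb)) `|(EFin \o f) t| = 0)%E.
  transitivity ((ray_integral f)%:E); last by rewrite I00.
  rewrite fE; apply: eq_integral => t; rewrite inE/= in_itv/= andbT => t0.
  by rewrite ger0_norm// f0.
have N := (@ae_eq_integral_abs _ Leb R leb _ measurable_ray (EFin \o f)
  (measurable_int _ fi)).1 aI0.
apply: ae_leb_imp N => t h t0.
have := h _; rewrite /= in_itv/= andbT => /(_ t0) [].
by [].
Qed.

End ray_integral.

(** * Finite sums on the graph *)

Section graph_sums.
Context {R : realType} {V : countType}.
Implicit Types (B : {fset V}) (F : V -> R).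

Lemma sum_setT_fset B F : (forall x, x \notin B -> F x = 0) ->
  \sum_(x \in [set: V]) F x = \sum_(x <- B) F x.
Proof. by move=> F0; rewrite (fsbigTE B). Qed.

Lemma esum_setT_fset B F : (forall x, 0 <= F x) -> (forall x, x \notin B -> F x = 0) ->
  (\esum_(x in [set: V]) (F x)%:E = \sum_(x <- B) (F x)%:E)%E.
Proof.
move=> Fge0 F0; transitivity (\esum_(x in [set` B]) (F x)%:E)%E.
  rewrite [RHS]esum_mkcond; apply: eq_esum => x _.
  by case: ifPn => //; rewrite notin_setE/= => /negP xB; rewrite F0.
rewrite esum_fset//; last by move=> x _; rewrite lee_fin.
by rewrite fsbig_finite//= set_fsetK.
Qed.

Variables (omega : V -> V -> R) (mu : V -> R).
Hypothesis graph : weighted_graph omega mu.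
Hypothesis lf : locally_finite omega.

Local Notation nbh x := [set y | Defs.adjacent omega x y].

Lemma not_adjacent x y : ~ Defs.adjacent omega x y -> omega x y = 0.
Proof.
move=> /negP; rewrite /Defs.adjacent -leNgt => h.
by apply/eqP; rewrite eq_le h (edge_weight_ge0 graph).
Qed.

Lemma sum_adjacent_setT x (c : V -> R) :
  \sum_(y \in nbh x) omega x y * c y = \sum_(y \in [set: V]) omega x y * c y.
Proof.
apply: fsbig_widen => // y [_ /= h].
by rewrite not_adjacent// mul0r.
Qed.

Lemma sum_adjacent_fset B x (c : V -> R) :
  (forall y, y \notin B -> omega x y * c y = 0) ->
  \sum_(y \in nbh x) omega x y * c y = \sum_(y <- B) omega x y * c y.
Proof. by move=> h; rewrite sum_adjacent_setT; exact: sum_setT_fset. Qed.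

Lemma mu_laplacian (f : V -> R) x :
  mu x * laplacian omega mu f x = \sum_(y \in nbh x) omega x y * (f y - f x).
Proof.
by rewrite /laplacian mulrA mulfV ?mul1r// gt_eqF// (vertex_weight_gt0 graph).
Qed.

Lemma mu_laplacian_nbh (f : V -> R) x :
  mu x * laplacian omega mu f x =
  \sum_(y <- fset_set (nbh x)) omega x y * (f y - f x).
Proof. by rewrite mu_laplacian fsbig_finite//; exact: lf. Qed.

Lemma finite_neighborhood (A : set V) : finite_set A ->
  exists B : {fset V}, (forall x, A x -> x \in B) /\
    (forall x y, A x -> Defs.adjacent omega x y -> y \in B).
Proof.
move=> fA; have fN : finite_set (\bigcup_(x in A) nbh x).
  by apply: bigcup_finite => // x _; exact: lf.
exists (fset_set A `|` fset_set (\bigcup_(x in A) nbh x))%fset.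
split => [x Ax|x y Ax xy]; rewrite in_fsetU; apply/orP; [left|right].
  by rewrite in_fset_set//; exact: mem_set.
by rewrite in_fset_set//; apply: mem_set; exists x.
Qed.

(** Summation by parts. The finite set [B] contains the support [A] of [phi] and all
    its neighbours, so both sides are sums over the edges within [B], and they are
    exchanged by the symmetry of the edge weights. *)
Lemma laplacian_symmetric (A : set V) B (u phi : V -> R) :
  (forall x, A x -> x \in B) ->
  (forall x y, A x -> Defs.adjacent omega x y -> y \in B) ->
  (forall x, ~ A x -> phi x = 0) ->
  \sum_(x \in [set: V]) laplacian omega mu u x * phi x * mu x =
  \sum_(x <- B) u x * (mu x * laplacian omega mu phi x).
Proof.
move=> AB NB phi0.
rewrite (sum_setT_fset (B := B)); last first.
  by move=> x /negP xB; rewrite phi0 ?mulr0 ?mul0r// => /AB.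
have L x : laplacian omega mu u x * phi x * mu x =
    \sum_(y <- B) omega x y * (u y * phi x - u x * phi x).
  rewrite mulrC mulrA mu_laplacian.
  have [Ax|nAx] := pselect (A x); last first.
    by rewrite phi0// mulr0 big1// => y _; rewrite !mulr0 subrr mulr0.
  rewrite (sum_adjacent_fset (B := B)).
    by rewrite mulr_suml; apply: eq_bigr => y _; ring.
  move=> y /negP yB; rewrite not_adjacent ?mul0r// => xy.
  by apply: yB; exact: NB xy.
have M x : u x * (mu x * laplacian omega mu phi x) =
    \sum_(y <- B) omega x y * (u x * phi y - u x * phi x).
  rewrite mu_laplacian (sum_adjacent_fset (B := B)).
    by rewrite mulr_sumr; apply: eq_bigr => y _; ring.
  move=> y /negP yB.
  have [Ax|nAx] := pselect (A x).
    by rewrite not_adjacent ?mul0r// => xy; apply: yB; exact: NB xy.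
  by rewrite !phi0 ?subrr ?mulr0// => /AB.
under eq_bigr do rewrite L.
under [RHS]eq_bigr do rewrite M.
under eq_bigr do rewrite (eq_bigr _ (fun y _ => mulrBr _ _ _)) sumrB.
under [RHS]eq_bigr do rewrite (eq_bigr _ (fun y _ => mulrBr _ _ _)) sumrB.
rewrite !sumrB; congr (_ - _).
rewrite exchange_big/=; apply: eq_bigr => x _; apply: eq_bigr => y _.
by rewrite (edge_weight_sym graph).
Qed.

(** The geometric assumptions, rewritten as statements about the finite list of
    neighbours of each vertex. *)
Lemma nbh_laplacian_hyps (d : V -> V -> R) (x0 : V) (R0 alpha j : R) :
  pseudo_metric d ->
  (forall x y, 0 < omega x y -> d x y <= j) ->
  (exists2 C : R, 0 < C & forall x, \sum_(y \in nbh x) omega x y <= C * mu x) ->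
  (exists2 C : R, 0 < C & forall x, ~ dball d x0 R0 x ->
      laplacian omega mu (d ^~ x0) x <= C / d x x0 `^ alpha) ->
  exists C1 C2 : R, [/\ 0 <= C1, 0 <= C2 & forall x,
    [/\ forall y, 0 < omega x y -> `|d y x0 - d x x0| <= j,
      \sum_(y <- fset_set (nbh x)) omega x y <= C1 * mu x &
      R0 <= d x x0 -> \sum_(y <- fset_set (nbh x)) omega x y * (d y x0 - d x x0)
         <= mu x * (C2 / d x x0 `^ alpha)]].
Proof.
move=> pd dj [C1 C10 H1] [C2 C20 H2]; exists C1, C2; split; rewrite ?ltW// => x; split.
- move=> y wxy; have := pseudo_metric_triangle pd x y x0.
  have := pseudo_metric_triangle pd y x x0; rewrite (pseudo_metric_sym pd y x).
  have := dj _ _ wxy; rewrite ler_norml => *; apply/andP; split; lra.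
- by rewrite -fsbig_finite//; exact: lf.
- move=> xR0; rewrite -mu_laplacian_nbh.
  rewrite ler_wpM2l ?(ltW (vertex_weight_gt0 graph _))//.
  by apply: H2; rewrite /dball/= (pseudo_metric_sym pd); apply/negP; rewrite -leNgt.
Qed.

End graph_sums.

(** * Integrability against the cutoff *)

Section ray_profile.
Context {R : realType}.
Local Notation ray := (`[0%R, +oo[%classic : set R).

Lemma integral_sum_ray (V : Type) (s : seq V) (F : V -> R -> R) :
  (forall x t, 0 <= t -> 0 <= F x t) ->
  (forall x, lebesgue_measurable_fun ray (F x)) ->
  (\int[leb]_(t in ray) (\sum_(x <- s) (F x t)%:E) =
   \sum_(x <- s) \int[leb]_(t in ray) (F x t)%:E)%E.
Proof.
move=> F0 mF.
have mF' x := (measurable_EFinP _ _).2 (mF x).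
have F0' x (t : R) : ray t -> (0 <= (F x t)%:E)%E.
  by rewrite /= in_itv/= andbT lee_fin => t0; exact: F0.
exact: (@ge0_integral_sum _ _ R leb _ measurable_ray V
  (fun x t => (F x t)%:E) mF' F0' s).
Qed.

(** An infinite integral in the sum is harmless here, because [ray_integral] then
    takes the value [0]; integrability is [sum_ray_integrable]. *)
Lemma sum_ray_integral_le (V : Type) (s : seq V) (F : V -> R -> R) (c : R) :
  (forall x t, 0 <= t -> 0 <= F x t) ->
  (forall x, lebesgue_measurable_fun ray (F x)) ->
  (\int[leb]_(t in ray) (\sum_(x <- s) (F x t)%:E) <= c%:E)%E ->
  \sum_(x <- s) ray_integral (F x) <= c.
Proof.
move=> F0 mF; rewrite (integral_sum_ray s F0 mF).
have F0' x (t : R) : ray t -> (0 <= (F x t)%:E)%E.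
  by rewrite /= in_itv/= andbT lee_fin => t0; exact: F0.
move=> h.
have : ((\sum_(x <- s) ray_integral (F x))%:E <= c%:E)%E; last by rewrite lee_fin.
apply: le_trans h; rewrite -sumEFin; apply: lee_sum => x _.
rewrite /ray_integral /Rintegral.
have [->|fi] := eqVneq (\int[leb]_(t in ray) (F x t)%:E)%E (+oo)%E.
  exact: leey.
rewrite fineK// ge0_fin_numE ?integral_ge0//; last exact: F0'.
by rewrite ltey.
Qed.

Lemma sum_ray_integrable (V : eqType) (s : seq V) (F : V -> R -> R) (c : R) :
  (forall x t, 0 <= t -> 0 <= F x t) ->
  (forall x, lebesgue_measurable_fun ray (F x)) ->
  (\int[leb]_(t in ray) (\sum_(x <- s) (F x t)%:E) <= c%:E)%E ->
  forall x, x \in s -> ray_integrable (F x).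
Proof.
move=> F0 mF; rewrite (integral_sum_ray s F0 mF).
have F0' x (t : R) : ray t -> (0 <= (F x t)%:E)%E.
  by rewrite /= in_itv/= andbT lee_fin => t0; exact: F0.
move=> h x xs; apply/integrableP; split; first exact/measurable_EFinP/mF.
have -> : (\int[leb]_(t in ray) `|(EFin \o F x) t| = \int[leb]_(t in ray) (F x t)%:E)%E.
  apply: eq_integral => t; rewrite inE => tr /=.
  by rewrite ger0_norm// -lee_fin; exact: F0'.
apply: le_lt_trans (ltry c); apply: le_trans h.
rewrite (big_rem x xs)/= leeDl// sume_ge0// => y _.
by apply: integral_ge0; exact: F0'.
Qed.

Variables (n : nat) (th1 th2 : R).
Hypotheses (th12 : 2 <= th1) (th22 : 2 <= th2).

Lemma continuous_ray_measurable (f : R -> R) :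
  {within ray, continuous f} -> lebesgue_measurable_fun ray f.
Proof.
move=> cf; apply: borel_lebesgue_measurable_fun; first exact: measurable_itv.
by apply: subspace_continuous_measurable_fun => //; exact: measurable_itv.
Qed.

Lemma measurable_profile r D :
  lebesgue_measurable_fun ray (profile n.+3 th1 th2 r D).
Proof.
apply: continuous_ray_measurable; apply: within_continuous_comp.
  move=> z _; apply: differentiable_continuous; apply/derivable1_diffP.
  exact: (@ex_derive _ _ _ _ _ _ _ (is_derive_cutoff n.+1 _)).
exact: continuous_level_ray (le_trans (ler0n _ 2) th22).
Qed.

Lemma measurable_profile2 r D :
  lebesgue_measurable_fun ray (profile2 n.+3 th1 th2 r D).
Proof. by apply: continuous_ray_measurable; exact: continuous_profile2. Qed.

Lemma measurable_in_level r D :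
  lebesgue_measurable_fun ray (fun t => (in_level th1 th2 r D t)%:R : R).
Proof.
have -> : (fun t => (in_level th1 th2 r D t)%:R : R) =
   (\1_(`[1, 2]%classic : set R) : R -> R) \o (fun t => level th1 r D (t `^ th2)).
  apply/funext => t /=; rewrite indicE /in_level; congr (_%:R).
  by congr nat_of_bool; apply/idP/idP; rewrite inE/= in_itv.
apply: lebesgue_measurable_comp; first exact: measurable_indic.
apply: continuous_ray_measurable.
exact: continuous_level_ray (le_trans (ler0n _ 2) th22).
Qed.

Lemma level_gt2_late r D t : 1 <= r -> 1 + 2 * r `^ th1 <= t ->
  2 < level th1 r D (t `^ th2).
Proof.
have [? ?] := (th12, th22).
move=> r1 tr; rewrite /level ltr_pdivlMr ?powR_gt0//; last lra.
have r0 : 0 < r `^ th1 by rewrite powR_gt0//; lra.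
have : t <= t `^ th2 by rewrite le1r_powR//; lra.
have := powR_ge0 D th1; lra.
Qed.

Lemma level_gt2_far r D t : 0 < r -> 2 * r <= D ->
  2 < level th1 r D (t `^ th2).
Proof.
have [? ?] := (th12, th22).
move=> r0 Dr; have h : (2 * r / r) `^ th1 <= level th1 r D (t `^ th2).
  apply: level_ge => //; [exact: powR_ge0|lra|lra].
apply: lt_le_trans h; rewrite mulfK ?gt_eqF//.
have : (2 : R) `^ 2 <= 2 `^ th1 by rewrite ler_powR//; lra.
rewrite powR_mulrn//; lra.
Qed.

Lemma profile_eq0 r D t : 2 < level th1 r D (t `^ th2) ->
  profile n.+3 th1 th2 r D t = 0.
Proof. by move=> L; rewrite /profile cutoff_eq0// ltW. Qed.

Lemma profile12_eq0 r D t : 2 < level th1 r D (t `^ th2) ->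
  profile1 n.+3 th1 th2 r D t = 0 /\ profile2 n.+3 th1 th2 r D t = 0.
Proof.
move=> L; rewrite /profile1 /profile2.
by have [|-> ->] := @cutoff12_eq0 R n _ (_ : _ || (2 < level th1 r D (t `^ th2)));
  rewrite ?L ?orbT// !mul0r addr0.
Qed.

Lemma profile2_bounded r D : 1 <= r ->
  exists M : R, forall t, 0 <= t -> `|profile2 n.+3 th1 th2 r D t| <= M.
Proof.
have [? ?] := (th12, th22).
move=> r1.
(* After the time T the level exceeds 2; before it, the powers of t are at most
   those of T. *)
set T := 1 + 2 * r `^ th1.
exists (60 * n.+3%:R ^+ 2 * (th2 / r `^ th1 * T `^ (th2 - 1)) ^+ 2 +
  6 * n.+3%:R * (th2 * (th2 - 1) / r `^ th1 * T `^ (th2 - 2))).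
move=> t t0.
have T0 : 0 <= T by rewrite addr_ge0// mulr_ge0// powR_ge0.
have i0 : 0 <= (r `^ th1)^-1 by rewrite invr_ge0 powR_ge0.
have a0 s : 0 <= th2 / r `^ th1 * s `^ (th2 - 1).
  by rewrite mulr_ge0 ?powR_ge0// mulr_ge0//; lra.
have b0 s : 0 <= th2 * (th2 - 1) / r `^ th1 * s `^ (th2 - 2).
  by rewrite mulr_ge0 ?powR_ge0// mulr_ge0// mulr_ge0//; lra.
have [Tt|tT] := leP T t.
  have [_ ->] := profile12_eq0 (level_gt2_late D r1 Tt).
  by rewrite normr0 addr_ge0// mulr_ge0// ?sqr_ge0// mulr_ge0// sqr_ge0.
have [c1 c2] := @cutoff12_le R n (level th1 r D (t `^ th2)).
have /andP[g0 g1] := plateau01 (level th1 r D (t `^ th2)).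
have G1 : plateau (level th1 r D (t `^ th2)) ^+ n.+1 <= 1 by rewrite exprn_ile1.
have a1 : th2 / r `^ th1 * t `^ (th2 - 1) <= th2 / r `^ th1 * T `^ (th2 - 1).
  rewrite ler_wpM2l//; first by rewrite mulr_ge0//; lra.
  by apply: ge0_ler_powR; rewrite ?nnegrE ?(ltW tT)//; lra.
have b1 : th2 * (th2 - 1) / r `^ th1 * t `^ (th2 - 2) <=
    th2 * (th2 - 1) / r `^ th1 * T `^ (th2 - 2).
  rewrite ler_wpM2l//; first by rewrite mulr_ge0// mulr_ge0//; lra.
  by apply: ge0_ler_powR; rewrite ?nnegrE ?(ltW tT)//; lra.
rewrite /profile2 (le_trans (ler_normD _ _))// (normrM (cutoff2 _ _)).
rewrite (normrM (cutoff1 _ _)) (ger0_norm (b0 t)).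
rewrite (ger0_norm (sqr_ge0 _)).
have N0 : 0 <= n.+3%:R :> R by [].
apply: lerD; apply: ler_pM => //; rewrite ?sqr_ge0//.
- apply: (le_trans c2); rewrite ler_piMr// mulr_ge0// exprn_ge0//.
- by rewrite lerXn2r// ?nnegrE.
- by apply: (le_trans c1); rewrite ler_piMr// mulr_ge0.
Qed.

Lemma integrable_mul_profile f r D : 1 <= r -> L1loc_ray f ->
  ray_integrable (fun t => f t * profile n.+3 th1 th2 r D t).
Proof.
move=> r1 fL; apply: (@L1loc_cutoff_integrable _ _ _ (1 + 2 * r `^ th1) 1) => //.
- by rewrite ltr_pwDl// mulr_ge0// powR_ge0.
- exact: measurable_profile.
- move=> t t0; have /andP[p0 p1] := profile01 n.+3 th1 th2 r D t.
  by rewrite ger0_norm.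
- by move=> t tT; apply: profile_eq0; exact: level_gt2_late.
Qed.

Lemma integrable_mul_profile2 f r D : 1 <= r -> L1loc_ray f ->
  ray_integrable (fun t => f t * profile2 n.+3 th1 th2 r D t).
Proof.
move=> r1 fL; have [M HM] := profile2_bounded D r1.
apply: (@L1loc_cutoff_integrable _ _ _ (1 + 2 * r `^ th1) M) => //.
- by rewrite ltr_pwDl// mulr_ge0// powR_ge0.
- exact: measurable_profile2.
- by move=> t tT; apply: (profile12_eq0 _).2; exact: level_gt2_late.
Qed.

Lemma integrable_mul_profile_level f r D : 1 <= r -> L1loc_ray f ->
  ray_integrable (fun t => f t *
    (profile n.+3 th1 th2 r D t * (in_level th1 th2 r D t)%:R)).
Proof.
move=> r1 fL; apply: (@L1loc_cutoff_integrable _ _ _ (1 + 2 * r `^ th1) 1) => //.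
- by rewrite ltr_pwDl// mulr_ge0// powR_ge0.
- apply: lebesgue_measurable_mul; first exact: measurable_profile.
  exact: measurable_in_level.
- move=> t t0; have /andP[p0 p1] := profile01 n.+3 th1 th2 r D t.
  by rewrite normrM !ger0_norm// mulr_ile1//; case: in_level.
- by move=> t tT; rewrite profile_eq0 ?mul0r//; exact: level_gt2_late.
Qed.

End ray_profile.

(** * Energy estimates for a weak solution *)

Section weak_inequality.
Context {R : realType} {V : countType}.
Variables (omega : V -> V -> R) (mu : V -> R) (d : V -> V -> R) (x0 : V).
Variables (R0 alpha : R) (v : V -> R -> R) (sigma th1 th2 : R).
Variables (u0 u1 : V -> R) (u : V -> R -> R).
Hypothesis graph : weighted_graph omega mu.
Hypothesis A : assumption_A omega mu d x0 R0 alpha.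
Hypothesis v_measurable : forall x, lebesgue_measurable_fun `[0, +oo[ (v x).
Hypothesis v_gt0 : forall (x : V) (t : R), 0 <= t -> 0 < v x t.
Hypothesis sigma_gt1 : 1 < sigma.
Hypothesis th1_ge2 : 2 <= th1.
Hypothesis th2_ge2 : 2 <= th2.
Hypothesis th_ratio : th1 / th2 >= (1 + alpha) / 2.
Hypothesis v_growth : exists2 C : R, 0 < C & forall r : R, R0 <= r ->
  (\int[leb]_(t in `[0%R, +oo[)
      (\esum_(x in [set: V])
        (\1_(annulus d x0 th1 th2 r) (x, t)
           * v x t `^ (- (sigma - 1)^-1) * mu x)%:E)
   <= (C * r `^ ((1 + alpha) * sigma / (sigma - 1)))%:E)%E.
Hypothesis u_ge0 : forall x, {ae leb, forall t : R, 0 <= t -> 0 <= u x t}.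
Hypothesis u_solution : very_weak_solution omega mu v sigma u0 u1 u.

Local Notation ray := (`[0%R, +oo[%classic : set R).
Local Notation p := ((sigma - 1)^-1).

Variable n : nat.
Hypothesis n_large : 2 * p <= n.+1%:R.

Definition testf r x t : R := profile n.+3 th1 th2 r (d x x0) t.

Definition on_annulus r x t : R := (in_level th1 th2 r (d x x0) t)%:R.

(** The nonlinear term of the inequality. *)
Definition density x t : R := v x t * `|u x t| `^ sigma.

(** [mu x] times the wave operator applied to the test function, in the form in which
    summation by parts produces it. *)
Definition wave_testf r x t : R :=
  mu x * profile2 n.+3 th1 th2 r (d x x0) t - mu x * laplacian omega mu (testf r ^~ t) x.

(** The space-time integral of the nonlinear term against the test function. The
    sum has finite support, since the test function vanishes far away. *)
Definition energy r : R :=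
  \sum_(x \in [set: V]) mu x * ray_integral (fun t => density x t * testf r x t).

Definition annulus_energy r : R :=
  \sum_(x \in [set: V]) mu x *
    ray_integral (fun t => density x t * (testf r x t * on_annulus r x t)).

Definition velocity_gap r : R :=
  \sum_(x \in dball d x0 r) u1^\+ x * mu x
  - \sum_(x \in dball d x0 (2 * r)) u1^\- x * mu x.

Let pd : pseudo_metric d := A_pseudo_metric A.

Lemma far_level r x t : 0 < r -> ~ dball d x0 (2 * r) x ->
  2 < level th1 r (d x x0) (t `^ th2).
Proof.
move=> r0 /negP; rewrite -leNgt (pseudo_metric_sym pd) => xr.
exact: level_gt2_far.
Qed.

Lemma testf_far r x t : 0 < r -> ~ dball d x0 (2 * r) x -> testf r x t = 0.
Proof. by move=> r0 xr; apply: profile_eq0; exact: far_level. Qed.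

Lemma test_function_testf r : 1 <= r -> test_function (testf r).
Proof.
move=> r1; have r0 : 0 < r by lra.
split.
- by move=> x t _; have /andP[] := profile01 n.+3 th1 th2 r (d x x0) t.
- exists (1 + 2 * r `^ th1), (dball d x0 (2 * r)); split.
  + by rewrite ltr_pwDl// mulr_ge0// powR_ge0.
  + by apply: (A_finite_balls A); rewrite mulr_gt0.
  + move=> [x t]/= [t0 /eqP ct]; split => /=.
      by apply: contrapT => h; apply: ct; exact: testf_far.
    rewrite in_itv/= t0/= leNgt; apply/negP => /ltW h; apply: ct.
    by apply: profile_eq0; exact: level_gt2_late.
- by move=> x; exact: C2_ray_profile.
Qed.

Lemma density_L1loc x : L1loc_ray (density x).
Proof. exact: (vws_Lsigma u_solution). Qed.

Lemma u_L1loc x : L1loc_ray (u x).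
Proof. exact: (vws_L1 u_solution). Qed.

Lemma abs_u_L1loc x : L1loc_ray (fun t => `|u x t|).
Proof.
by move=> T T0; have := u_L1loc x T0 => /integrable_abse.
Qed.

Lemma wave_testfE r x t : wave_testf r x t =
  mu x * profile2 n.+3 th1 th2 r (d x x0) t
  - \sum_(y <- fset_set [set y | Defs.adjacent omega x y])
       omega x y * (testf r y t - testf r x t).
Proof. by rewrite /wave_testf (mu_laplacian_nbh graph (A_locally_finite A)). Qed.

Lemma integrable_mul_wave_testf f r x : 1 <= r -> L1loc_ray f ->
  ray_integrable (fun t => f t * wave_testf r x t).
Proof.
move=> r1 fL.
set s := fset_set [set y | Defs.adjacent omega x y].
have : ray_integrable (fun t =>
    mu x * (f t * profile2 n.+3 th1 th2 r (d x x0) t) +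
    \sum_(y <- s) (- omega x y * (f t * testf r y t) + omega x y * (f t * testf r x t))).
  apply: ray_integrableD.
    by apply: ray_integrableZ; exact: integrable_mul_profile2.
  apply: ray_integrable_sum => y.
  by apply: ray_integrableD; apply: ray_integrableZ; exact: integrable_mul_profile.
apply: eq_ray_integrable => t t0.
rewrite wave_testfE -/s mulrBr mulr_sumr -sumrN; congr (_ + _); first by ring.
by apply: eq_bigr => y _; ring.
Qed.

(** The solution is nonnegative almost everywhere only; its absolute value is
    nonnegative at every time, as pointwise estimates require. *)
Lemma ae_abs_u_integral r x : 1 <= r ->
  ray_integral (fun t => u x t * wave_testf r x t) =
  ray_integral (fun t => `|u x t| * wave_testf r x t).
Proof.
move=> r1; apply: ae_eq_ray_integral.
- by apply: integrable_mul_wave_testf => //; exact: u_L1loc.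
- by apply: integrable_mul_wave_testf => //; exact: abs_u_L1loc.
- by apply: ae_leb_imp (u_ge0 x) => t h t0; rewrite ger0_norm ?h.
Qed.

(** The weak inequality tested with [testf r], after summation by parts in space. The
    term in [u0] is gone because the test function is stationary at time [0]. *)
Lemma weighted_density_le r (B : {fset V}) : 1 <= r ->
  (forall x, dball d x0 (2 * r) x -> x \in B) ->
  (forall x y, dball d x0 (2 * r) x -> Defs.adjacent omega x y -> y \in B) ->
  \sum_(x <- B) mu x * ray_integral (fun t => density x t * testf r x t) <=
  \sum_(x <- B) ray_integral (fun t => u x t * wave_testf r x t)
  - \sum_(x \in [set: V]) u1 x * testf r x 0 * mu x.
Proof.
move=> r1 AB NB; have r0 : 0 < r by lra.
have far x : x \notin B -> ~ dball d x0 (2 * r) x by move=> /negP h /AB.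
have p2_0 x t : x \notin B -> 0 <= t -> ray_derive (ray_derive (testf r x)) t = 0.
  move=> xB t0; rewrite ray_derive2_profile//.
  by apply: (profile12_eq0 _ _).2; apply: far_level => //; exact: far.
have := vws_ineq u_solution (test_function_testf r1).
rewrite [X in _ - _ + X - _](_ : _ = 0); last first.
  rewrite (sum_setT_fset (B := B)).
    by rewrite big1// => x _; rewrite ray_derive_profile// profile1_t0// mulr0 mul0r.
  by move=> x _; rewrite ray_derive_profile// profile1_t0// mulr0 mul0r.
rewrite addr0.
have -> : (\int[leb]_(t in `[0, +oo[) (\sum_(x \in [set: V])
      v x t * `|u x t| `^ sigma * testf r x t * mu x))%R =
    \sum_(x <- B) mu x * ray_integral (fun t => density x t * testf r x t).
  transitivity (ray_integral (fun t => \sum_(x <- B) mu x * (density x t * testf r x t))).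
    apply: eq_ray_integral => t t0; rewrite (sum_setT_fset (B := B)).
      by apply: eq_bigr => x _; rewrite mulrC.
    by move=> x /far xB; rewrite testf_far// mulr0 mul0r.
  have I x : ray_integrable (fun t => density x t * testf r x t).
    by apply: integrable_mul_profile => //; exact: density_L1loc.
  rewrite ray_integral_sum; last by move=> x; exact: ray_integrableZ.
  by apply: eq_bigr => x _; rewrite ray_integralZ.
have I2 x : ray_integrable (fun t =>
    mu x * (u x t * profile2 n.+3 th1 th2 r (d x x0) t)).
  by apply: ray_integrableZ; apply: integrable_mul_profile2 => //; exact: u_L1loc.
have IL x : ray_integrable (fun t => u x t * (mu x * laplacian omega mu (testf r ^~ t) x)).
  have h : ray_integrable (fun t =>
      mu x * (u x t * profile2 n.+3 th1 th2 r (d x x0) t) + -1 * (u x t * wave_testf r x t)).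
    apply: ray_integrableD => //; apply: ray_integrableZ.
    by apply: integrable_mul_wave_testf => //; exact: u_L1loc.
  by apply: eq_ray_integrable h => t t0; rewrite /wave_testf; ring.
have -> : (\int[leb]_(t in `[0, +oo[) (\sum_(x \in [set: V])
      u x t * ray_derive (ray_derive (testf r x)) t * mu x))%R =
    \sum_(x <- B) ray_integral (fun t =>
      mu x * (u x t * profile2 n.+3 th1 th2 r (d x x0) t)).
  rewrite -ray_integral_sum//; apply: eq_ray_integral => t t0.
  rewrite (sum_setT_fset (B := B)); last by move=> x xB; rewrite p2_0// mulr0 mul0r.
  by apply: eq_bigr => x _; rewrite ray_derive2_profile//; ring.
have -> : (\int[leb]_(t in `[0, +oo[) (\sum_(x \in [set: V])
      laplacian omega mu (u ^~ t) x * testf r x t * mu x))%R =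
    \sum_(x <- B) ray_integral (fun t =>
      u x t * (mu x * laplacian omega mu (testf r ^~ t) x)).
  rewrite -ray_integral_sum//; apply: eq_ray_integral => t t0.
  apply: (@laplacian_symmetric _ _ _ _ graph
    (dball d x0 (2 * r)) B (u ^~ t) (testf r ^~ t) AB NB).
  by move=> x xr; exact: testf_far.
rewrite -sumrB => h; apply: (le_trans h).
rewrite lerD2r; apply: ler_sum => x _.
rewrite -ray_integralB//; apply: le_ray_integral.
- have := ray_integrableD (I2 x) (ray_integrableZ (-1) (IL x)).
  by apply: eq_ray_integrable => t _; rewrite mulN1r.
- by apply: integrable_mul_wave_testf => //; exact: u_L1loc.
- by move=> t t0; rewrite /wave_testf mulrBr mulrCA.
Qed.

Lemma annulusE r x t : 1 <= r -> 0 <= t ->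
  \1_(annulus d x0 th1 th2 r) (x, t) = on_annulus r x t.
Proof.
move=> r1 t0; rewrite indicE /on_annulus /in_level /level; congr (_%:R).
congr nat_of_bool; have h : 0 < r `^ th1 by rewrite powR_gt0//; lra.
rewrite ler_pdivlMr// ler_pdivrMr// mul1r.
by apply/idP/idP => [/set_mem[]//|k]; apply: mem_set; split.
Qed.


Lemma on_annulus01 r x t : 0 <= on_annulus r x t <= 1.
Proof. by rewrite /on_annulus ler0n lern1 leq_b1. Qed.

Lemma on_annulus_far r x t : 0 < r -> ~ dball d x0 (2 * r) x ->
  on_annulus r x t = 0.
Proof.
move=> r0 /(far_level t r0) h; rewrite /on_annulus /in_level.
by rewrite (leNgt _ 2) h andbF.
Qed.

(** The integrand of the volume growth hypothesis. *)
Definition dual_weight r x t : R := on_annulus r x t * v x t `^ (- p) * mu x.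

Lemma dual_weight_ge0 r x t : 0 <= t -> 0 <= dual_weight r x t.
Proof.
move=> t0; rewrite /dual_weight mulr_ge0 ?(ltW (vertex_weight_gt0 graph _))//.
by rewrite mulr_ge0 ?powR_ge0//; have /andP[] := on_annulus01 r x t.
Qed.

Lemma measurable_dual_weight r x : lebesgue_measurable_fun ray (dual_weight r x).
Proof.
have mc (c : R) : lebesgue_measurable_fun ray (fun=> c) by exact: measurable_cst.
have mw : lebesgue_measurable_fun ray (fun t => v x t `^ (- p)).
  by have := lebesgue_measurable_comp (@measurable_powR R (- p)) (v_measurable x).
have ma := @measurable_in_level R th1 th2 th2_ge2 r (d x x0).
exact: lebesgue_measurable_mul (lebesgue_measurable_mul ma mw) (mc (mu x)).
Qed.

(** At a given time only finitely many vertices meet the annulus, so the infinite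
    sum in the hypothesis is a sum over [B]. *)
Lemma dual_weight_bound : exists2 C : R, 0 <= C &
  forall r (B : {fset V}), R0 <= r ->
    (forall x, dball d x0 (2 * r) x -> x \in B) ->
    (forall x, x \in B -> ray_integrable (dual_weight r x)) /\
    \sum_(x <- B) ray_integral (dual_weight r x) <=
      C * r `^ ((1 + alpha) * sigma / (sigma - 1)).
Proof.
have [C C0 HC] := v_growth; exists C; first exact: ltW.
move=> r B rR0 AB; have := HC r rR0.
have r1 : 1 <= r by rewrite (le_trans _ rR0)// ltW// (A_R0 A).
have -> : (\int[leb]_(t in `[0%R, +oo[)
      (\esum_(x in [set: V])
        (\1_(annulus d x0 th1 th2 r) (x, t)
           * v x t `^ (- (sigma - 1)^-1) * mu x)%:E) =
    \int[leb]_(t in ray) (\sum_(x <- B) (dual_weight r x t)%:E))%E.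
  apply: eq_integral => t; rewrite inE/= in_itv/= andbT => t0.
  rewrite -esum_setT_fset.
  - by apply: eq_esum => x _; rewrite annulusE.
  - by move=> x; exact: dual_weight_ge0.
  - move=> x /negP xB; rewrite /dual_weight on_annulus_far ?mul0r//; first lra.
    by move=> /AB.
move=> H; split.
  apply: sum_ray_integrable H => x; first by move=> t; exact: dual_weight_ge0.
  exact: measurable_dual_weight.
apply: sum_ray_integral_le H => x; first by move=> t; exact: dual_weight_ge0.
exact: measurable_dual_weight.
Qed.

(** At time [0] the test function is [1] on the ball of radius [r], vanishes off the
    ball of radius [2 * r], and lies between [0] and [1]: this is the least favourable
    choice for each sign of [u1]. *)
Lemma velocity_gap_le r : 1 <= r ->
  velocity_gap r <= \sum_(x \in [set: V]) u1 x * testf r x 0 * mu x.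
Proof.
move=> r1; have r0 : 0 < r by lra.
have fB : finite_set (dball d x0 (2 * r)).
  by apply: (A_finite_balls A); rewrite mulr_gt0.
set B := fset_set (dball d x0 (2 * r)).
have BE x : x \notin B -> ~ dball d x0 (2 * r) x.
  by rewrite in_fset_set// notin_setE.
rewrite [in leRHS](sum_setT_fset (B := B)); last first.
  by move=> x /BE xB; rewrite testf_far// mulr0 mul0r.
rewrite /velocity_gap [X in _ - X]fsbig_finite// -/B.
have -> : \sum_(x \in dball d x0 r) u1^\+ x * mu x =
    \sum_(x <- B) (if x \in dball d x0 r then u1^\+ x * mu x else 0).
  rewrite fsbig_mkcond (sum_setT_fset (B := B)); last first.
    move=> x /BE xB; rewrite patchE ifN// notin_setE => xr; apply: xB.
    by move: xr; rewrite /dball/= => h; lra.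
  by apply: eq_bigr => x _; rewrite patchE.
rewrite -sumrB; apply: ler_sum => x _.
have m0 := vertex_weight_gt0 graph x.
have /andP[c0 c1] := profile01 n.+3 th1 th2 r (d x x0) 0.
have u1E : u1 x = u1^\+ x - u1^\- x
  := esym (congr1 (fun f : V -> R => f x) (funrposBneg u1)).
have p0 : 0 <= u1^\+ x by exact: funrpos_ge0.
have q0 : 0 <= u1^\- x by exact: funrneg_ge0.
rewrite u1E -/(testf r x 0) in c0 c1 *.
have -> : (u1^\+ x - u1^\- x) * testf r x 0 * mu x =
  testf r x 0 * (u1^\+ x * mu x) - testf r x 0 * (u1^\- x * mu x) by ring.
apply: lerB; last by rewrite ler_piMl// mulr_ge0// ltW.
case: ifPn => [/set_mem xr|_]; last by rewrite mulr_ge0// mulr_ge0// ltW.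
rewrite /testf profile_eq1_init ?mul1r//.
- by have := th1_ge2; lra.
- by apply/eqP; have := th2_ge2; lra.
- by rewrite (pseudo_metric_ge0 pd)/= (pseudo_metric_sym pd).
Qed.

Lemma energy_fset r (B : {fset V}) : 1 <= r ->
  (forall x, dball d x0 (2 * r) x -> x \in B) ->
  energy r = \sum_(x <- B) mu x * ray_integral (fun t => density x t * testf r x t) /\
  annulus_energy r = \sum_(x <- B) mu x *
    ray_integral (fun t => density x t * (testf r x t * on_annulus r x t)).
Proof.
move=> r1 AB; have r0 : 0 < r by lra.
have I0 : ray_integral (fun=> 0 : R) = 0.
  by rewrite /ray_integral Rintegral_cst ?mul0r//; exact: measurable_ray.
split; apply: sum_setT_fset => x /negP xB; rewrite -[RHS](mulr0 (mu x)) -I0;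
  congr (_ * _); apply: eq_ray_integral => t t0; rewrite testf_far ?mul0r ?mulr0//;
  by move=> /AB.
Qed.

Lemma jump_bound : exists2 j : R, 0 <= j & forall x y, 0 < omega x y -> d x y <= j.
Proof.
have h := A_jump_size A.
have ub x y : 0 < omega x y -> ((d x y)%:E <= jump_size omega d)%E.
  by move=> xy; apply: ereal_sup_ubound; exists (x, y).
case: (jump_size omega d) h ub => [j _ ub|//|_ ub].
- exists (Num.max 0 j); first by rewrite le_max lexx.
  by move=> x y /ub; rewrite lee_fin le_max => ->; rewrite orbT.
- by exists 0 => // x y /ub; rewrite leeNy_eq.
Qed.

(** The wave operator of the test function is bounded by
    [c * r `^ (- (1 + alpha)) * plateau ^+ n.+1] on the annulus; Young's inequality with
    the free weight [K] splits its product with the solution into [K] times the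
    nonlinear term on the annulus and a multiple of the dual weight. The growth of
    the latter compensates the power of [r] exactly, because
    [(1 + alpha) * sigma / (sigma - 1) = (1 + alpha) * (1 + p)]. *)
Lemma energy_le : exists c r1 : R, [/\ 0 <= c, 1 <= r1 &
  forall r K, r1 <= r -> 0 < K ->
    energy r <= K * annulus_energy r + c * K `^ (- p) - velocity_gap r].
Proof.
have [j j0 dj] := jump_bound.
have [C1 [C2 [C10 C20 HC]]] := nbh_laplacian_hyps graph (A_locally_finite A)
  pd dj (A_degree A) (A_laplacian_dist A).
have R00 : 0 <= R0 by have := A_R0 A; lra.
have [c [r1 [c0 r11 H]]] := profile2_laplacian_le n th1_ge2 th2_ge2 th_ratio
  (A_alpha A) R00 j0 C10 C20.
have [C C0 HW] := dual_weight_bound.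
exists (c `^ (1 + p) * C), (Num.max R0 r1); split.
- by rewrite mulr_ge0// powR_ge0.
- by rewrite le_max r11 orbT.
move=> r K; rewrite ge_max => /andP[rR0 rr1] K0.
have r1' : 1 <= r by lra.
have r0 : 0 < r by lra.
have [|B [AB NB]] := finite_neighborhood (A_locally_finite A)
    (A := dball d x0 (2 * r)).
  by apply: (A_finite_balls A); rewrite mulr_gt0.
have [-> ->] := energy_fset r1' AB.
have [WI WS] := HW r B rR0 AB.
apply: (le_trans (weighted_density_le r1' AB NB)).
apply: lerB; last exact: velocity_gap_le.
set ra := r `^ (- (1 + alpha)) in H.
have ra0 : 0 < ra by exact: powR_gt0.
have cra0 : 0 < c * ra by exact: mulr_gt0.
pose M : R := (c * ra) `^ (1 + p) * K `^ (- p).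
have M0 : 0 <= M by rewrite mulr_ge0 ?powR_ge0.
have step x : x \in B -> ray_integral (fun t => u x t * wave_testf r x t) <=
    K * (mu x * ray_integral (fun t => density x t * (testf r x t * on_annulus r x t)))
    + M * ray_integral (dual_weight r x).
  move=> xB; rewrite ae_abs_u_integral//.
  have I1 : ray_integrable (fun t => density x t * (testf r x t * on_annulus r x t)).
    by apply: integrable_mul_profile_level => //; exact: density_L1loc.
  have I2 := WI x xB.
  rewrite mulrA -(ray_integralZ (K * mu x) I1) -(ray_integralZ M I2).
  rewrite -ray_integralD; [|exact: ray_integrableZ..].
  apply: le_ray_integral.
  - by apply: integrable_mul_wave_testf => //; exact: abs_u_L1loc.
  - by apply: ray_integrableD; exact: ray_integrableZ.
  move=> t t0; have [Hj Hw Hd] := HC x.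
  have m0 := vertex_weight_gt0 graph x.
  have := H V (fset_set [set y | Defs.adjacent omega x y]) (omega x)
    (fun y => d y x0) (mu x) (d x x0) t r rr1 (ltW m0)
    (pseudo_metric_ge0 pd _ _) t0 (edge_weight_ge0 graph x)
    (fun y => pseudo_metric_ge0 pd y x0) Hj Hw Hd.
  rewrite -/ra -[leLHS]wave_testfE => h.
  apply: (le_trans (ler_wpM2l (normr_ge0 (u x t)) h)).
  set g := plateau _.
  have g01 : 0 <= g <= 1 by exact: plateau01.
  have y := young_cutoff sigma_gt1 erefl n_large cra0 K0 (v_gt0 x t0)
    (normr_ge0 (u x t)) g01.
  have /andP[i0 _] := on_annulus01 r x t.
  have cE : testf r x t = g ^+ n.+3 by rewrite /testf /profile cutoffE.
  rewrite /density /dual_weight cE.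
  apply: (@le_trans _ _ (mu x * on_annulus r x t * (`|u x t| * (c * ra * g ^+ n.+1)))).
    by rewrite le_eqVlt; apply/orP; left; apply/eqP; rewrite /on_annulus; ring.
  have mo : 0 <= mu x * on_annulus r x t by rewrite mulr_ge0// ltW.
  apply: (le_trans (ler_wpM2l mo y)).
  by rewrite le_eqVlt; apply/orP; left; apply/eqP; rewrite /M; ring.
rewrite big_seq; apply: (le_trans (ler_sum _ step)).
rewrite -big_seq big_split/= -!mulr_sumr lerD2l.
apply: (le_trans (ler_wpM2l M0 WS)).
have s0 : sigma - 1 != 0 by apply/eqP; have := sigma_gt1; lra.
have -> : (1 + alpha) * sigma / (sigma - 1) = (1 + alpha) * (1 + p) by field.
rewrite /M powRM ?(ltW c0) ?(ltW ra0)// /ra -powRrM mulNr powRN le_eqVlt.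
apply/orP; left; apply/eqP; field.
by rewrite gt_eqF// powR_gt0.
Qed.

Lemma testf_nondecr r r' x t : 0 < r -> r <= r' -> testf r x t <= testf r' x t.
Proof. by move=> r0 rr'; apply: profile_nondecr => //; have := th1_ge2; lra. Qed.

Lemma density_ge0 x t : 0 <= t -> 0 <= density x t.
Proof. by move=> t0; rewrite mulr_ge0 ?powR_ge0// ltW// v_gt0. Qed.

Lemma integrable_density_testf r x : 1 <= r ->
  ray_integrable (fun t => density x t * testf r x t).
Proof. by move=> r1; apply: integrable_mul_profile => //; exact: density_L1loc. Qed.

Lemma integrable_density_annulus r x : 1 <= r ->
  ray_integrable (fun t => density x t * (testf r x t * on_annulus r x t)).
Proof.
by move=> r1; apply: integrable_mul_profile_level => //; exact: density_L1loc.
Qed.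

Lemma ball_fset r : 0 < r -> exists B : {fset V},
  forall x, dball d x0 r x -> x \in B.
Proof.
move=> r0; exists (fset_set (dball d x0 r)) => x xr.
by rewrite in_fset_set; [exact: mem_set|exact: (A_finite_balls A)].
Qed.

Lemma energy_nondecr r r' : 1 <= r -> r <= r' -> energy r <= energy r'.
Proof.
move=> r1 rr'; have [|B HB] := @ball_fset (2 * r'); first lra.
rewrite (energy_fset (_ : 1 <= r') HB).1; last lra.
rewrite (energy_fset r1 (_ : forall x, dball d x0 (2 * r) x -> x \in B)).1; last first.
  by move=> x; rewrite /dball/= => h; apply: HB; rewrite /dball/=; lra.
apply: ler_sum => x _; apply: ler_wpM2l.
  exact: ltW (vertex_weight_gt0 graph x).
apply: le_ray_integral; [exact: integrable_density_testf|apply: integrable_density_testf; lra|].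
move=> t t0; rewrite ler_wpM2l ?density_ge0//; apply: testf_nondecr => //; lra.
Qed.

Lemma vertex_energy_le r x : 1 <= r ->
  mu x * ray_integral (fun t => density x t * testf r x t) <= energy r.
Proof.
move=> r1; have [|B HB] := @ball_fset (2 * r); first lra.
have ge0 y : 0 <= mu y * ray_integral (fun t => density y t * testf r y t).
  rewrite mulr_ge0 ?(ltW (vertex_weight_gt0 graph _))//.
  apply: ray_integral_ge0 => t t0; rewrite mulr_ge0 ?density_ge0//.
  by have /andP[] := profile01 n.+3 th1 th2 r (d y x0) t.
have HB' y : dball d x0 (2 * r) y -> y \in (x |` B)%fset.
  by move=> /HB yB; rewrite in_fset1U yB orbT.
rewrite (energy_fset r1 HB').1 (big_fsetD1 x) ?in_fset1U ?eqxx//=.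
by rewrite lerDl; apply: sumr_ge0 => y _; exact: ge0.
Qed.

Lemma energy_ge0 r : 1 <= r -> 0 <= energy r.
Proof.
move=> r1; apply: le_trans (vertex_energy_le x0 r1).
rewrite mulr_ge0 ?(ltW (vertex_weight_gt0 graph _))//.
apply: ray_integral_ge0 => t t0; rewrite mulr_ge0 ?density_ge0//.
by have /andP[] := profile01 n.+3 th1 th2 r (d x0 x0) t.
Qed.

Lemma annulus_energy_le r : 1 <= r -> annulus_energy r <= energy r.
Proof.
move=> r1; have [|B HB] := @ball_fset (2 * r); first lra.
have [-> ->] := energy_fset r1 HB.
apply: ler_sum => x _; apply: ler_wpM2l.
  exact: ltW (vertex_weight_gt0 graph x).
apply: le_ray_integral; [exact: integrable_density_annulus|exact: integrable_density_testf|].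
move=> t t0; rewrite ler_wpM2l ?density_ge0//.
have /andP[p0 _] := profile01 n.+3 th1 th2 r (d x x0) t.
by have /andP[_ i1] := on_annulus01 r x t; rewrite ler_piMr.
Qed.

(** Replaces dominated convergence: the part of the energy in the annulus is
    controlled by an increment of a monotone bounded function of the radius, hence
    tends to [0]. *)
Lemma annulus_energy_le_increment r : 2 <= r ->
  annulus_energy r <= energy (2 * r) - energy (r / 2).
Proof.
move=> r2; have [|B HB] := @ball_fset (2 * (2 * r)); first lra.
have sub k : 0 <= k -> k <= 2 * r -> forall x, dball d x0 (2 * k) x -> x \in B.
  by move=> k0 kr x; rewrite /dball/= => h; apply: HB; rewrite /dball/=; lra.
have e1 : 1 <= r by lra.
have e2 : 1 <= 2 * r by lra.
have e3 : 1 <= r / 2 by lra.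
rewrite (energy_fset e1 (sub _ _ _)).2; [|lra..].
rewrite (energy_fset e2 (sub _ _ _)).1; [|lra..].
rewrite (energy_fset e3 (sub _ _ _)).1; [|lra..].
rewrite -sumrB; apply: ler_sum => x _.
rewrite -mulrBr ler_wpM2l ?(ltW (vertex_weight_gt0 graph _))//.
have h1 := integrable_density_testf x e2; have h2 := integrable_density_testf x e3.
rewrite -(ray_integralB h1 h2); apply: le_ray_integral.
- exact: integrable_density_annulus.
- have := ray_integrableD h1 (ray_integrableZ (-1) h2).
  by apply: eq_ray_integrable => t _; rewrite mulN1r.
move=> t t0; rewrite -mulrBr ler_wpM2l ?density_ge0//.
have /andP[_ p1] := profile01 n.+3 th1 th2 r (d x x0) t.
rewrite /on_annulus; case L : (in_level th1 th2 r (d x x0) t); last first.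
  by rewrite mulr0 subr_ge0; apply: testf_nondecr; lra.
have r0 : 0 < r by lra.
have [] := profile_annulus n.+2 th1_ge2 r0 L.
by move=> E1 E2; rewrite /testf E1 E2 subr0 mulr1.
Qed.

End weak_inequality.

(** * Passage to the limit *)

Section vanishing.
Context {R : realType}.

Lemma limf_einf_pinfty_ge0 (S : R -> R) :
  (0 <= limf_einf (fun r => (S r)%:E) (pinfty_nbhs R))%E ->
  forall e, 0 < e -> exists r2, forall r, r2 <= r -> - e <= S r.
Proof.
rewrite limf_einfE => h e e0.
have : ((- e)%:E < ereal_sup [set ereal_inf ((fun r => (S r)%:E) @` V) |
    V in pinfty_nbhs R])%E.
  by apply: lt_le_trans h; rewrite lte_fin oppr_lt0.
move=> /ereal_sup_gt[_ [U [M [_ MU]] <-] h1].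
exists (M + 1) => r Mr; rewrite -lee_fin (le_trans (ltW h1))//.
by apply: ereal_inf_lbound; exists r => //; apply: MU; lra.
Qed.

(** With [K = 1 / 2] the inequality bounds [E], because [J <= E]. Being monotone and
    bounded, [E] has increments over [(r / 2, 2 * r)] that tend to [0], so for every
    fixed [K] the term [K * J r] disappears as [r] grows; the remaining constant
    [c * K `^ (- p)] is small for large [K]. *)
Lemma energy_vanishes (E J S : R -> R) (c r1 p : R) :
  0 < p -> 0 <= c ->
  (forall r, 1 <= r -> 0 <= E r) ->
  (forall r r', 1 <= r -> r <= r' -> E r <= E r') ->
  (forall r, 1 <= r -> J r <= E r) ->
  (forall r, 2 <= r -> J r <= E (2 * r) - E (r / 2)) ->
  (forall r K, r1 <= r -> 0 < K -> E r <= K * J r + c * K `^ (- p) - S r) ->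
  (forall e, 0 < e -> exists r2, forall r, r2 <= r -> - e <= S r) ->
  forall r, 1 <= r -> E r <= 0.
Proof.
move=> p0 c0 E0 Emono JE JD EJ HS.
have [M EM] : exists M, forall r, 1 <= r -> E r <= M.
  have [r2 Hr2] := HS 1 ltr01.
  exists (2 * (c * (1 / 2) `^ (- p) + 1)) => r r_ge1.
  pose s := Num.max r (Num.max r1 r2).
  have rs : r <= s by rewrite le_max lexx.
  have r1s : r1 <= s by rewrite !le_max lexx orbT.
  have r2s : r2 <= s by rewrite !le_max lexx !orbT.
  have := EJ s (1 / 2) r1s ltac:(lra); have := Hr2 s r2s.
  have := JE s ltac:(lra); have := Emono r s r_ge1 rs; lra.
pose L := sup [set E r | r in [set r | 1 <= r]].
have hs : has_sup [set E r | r in [set r | 1 <= r]].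
  by split; [exists (E 1), 1 => /= | exists M => _ [r /= /EM ? <-]].
have EL r : 1 <= r -> E r <= L.
  by move=> r_ge1; apply: ub_le_sup; [case: hs | exists r].
move=> r r_ge1; rewrite leNgt; apply/negP => Er.
pose e := E r / 4.
have e0 : 0 < e by rewrite /e; lra.
(* Chosen so that c * K `^ (- p) is at most e. *)
pose K := (e / (c + 1)) `^ (- p^-1).
have q0 : 0 < e / (c + 1) by rewrite divr_gt0//; lra.
have K0 : 0 < K by rewrite powR_gt0.
have Kp : c * K `^ (- p) <= e.
  rewrite /K -powRrM mulrNN mulVf ?gt_eqF// powRr1 ?(ltW q0)//.
  by rewrite mulrA ler_pdivrMr; [nra|lra].
have [_ [r3 /= r3_ge1 <-] Lr3] := sup_adherent (divr_gt0 e0 K0) hs.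
have [r2 Hr2] := HS e e0.
pose s := Num.max (r + 2 * r3) (Num.max r1 r2).
have rs : r + 2 * r3 <= s by rewrite le_max lexx.
have r1s : r1 <= s by rewrite !le_max lexx orbT.
have r2s : r2 <= s by rewrite !le_max lexx !orbT.
have J_le : J s <= e / K.
  have := JD s ltac:(lra); have := EL (2 * s) ltac:(lra).
  have := Emono r3 (s / 2) r3_ge1 ltac:(lra).
  move: Lr3; rewrite -/L; lra.
have KJ : K * J s <= e by rewrite mulrC -ler_pdivlMr.
have := EJ s K r1s K0; have := Hr2 s r2s.
have := Emono r s r_ge1 ltac:(lra).
have : E r = 4 * e by rewrite /e; lra.
lra.
Qed.

End vanishing.

Theorem theorem3p1 (R : realType) (V : countType)
  (omega : V -> V -> R) (mu : V -> R) (d : V -> V -> R)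
  (x0 : V) (R0 alpha : R)
  (v : V -> R -> R) (sigma theta1 theta2 : R) (u0 u1 : V -> R)
  (u : V -> R -> R)
  (Vinfinite : infinite_set [set: V])
  (graph : weighted_graph omega mu)
  (A : assumption_A omega mu d x0 R0 alpha)
  (v_measurable : forall x, lebesgue_measurable_fun `[0, +oo[ (v x))
  (v_gt0 : forall (x : V) (t : R), 0 <= t -> 0 < v x t)
  (sigma_gt1 : 1 < sigma)
  (theta1_ge2 : 2 <= theta1)
  (theta2_ge2 : 2 <= theta2)
  (theta_ratio : theta1 / theta2 >= (1 + alpha) / 2)
  (v_growth : exists2 C : R, 0 < C & forall r : R, R0 <= r ->
    (\int[leb]_(t in `[0%R, +oo[)
        (\esum_(x in [set: V])
          (\1_(annulus d x0 theta1 theta2 r) (x, t)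
             * v x t `^ (- (sigma - 1)^-1) * mu x)%:E)
     <= (C * r `^ ((1 + alpha) * sigma / (sigma - 1)))%:E)%E)
  (u1_liminf : (0 <= limf_einf (fun r : R =>
      (\sum_(x \in dball d x0 r) u1^\+ x * mu x
       - \sum_(x \in dball d x0 (2 * r)) u1^\- x * mu x)%:E)
    (pinfty_nbhs R))%E)
  (u_ge0 : forall x, {ae leb, forall t : R, 0 <= t -> 0 <= u x t})
  (u_solution : very_weak_solution omega mu v sigma u0 u1 u) :
  forall x, {ae leb, forall t : R, 0 <= t -> u x t = 0}.
Proof.
have p0 : 0 < (sigma - 1)^-1 by rewrite invr_gt0; lra.
(* The cutoff is raised to the power n.+3, large enough for Young's inequality. *)
pose n := Num.truncn (2 * (sigma - 1)^-1).
have n_large : 2 * (sigma - 1)^-1 <= n.+1%:R by rewrite ltW// truncnS_gt.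
have [c [r1 [c0 r11 EJ]]] := energy_le graph A v_measurable v_gt0 sigma_gt1
  theta1_ge2 theta2_ge2 theta_ratio v_growth u_ge0 u_solution n_large.
have E0 := energy_vanishes p0 c0
  (energy_ge0 sigma u graph A v_gt0 theta1_ge2 theta2_ge2 n)
  (energy_nondecr graph A v_gt0 theta1_ge2 theta2_ge2 u_solution n)
  (annulus_energy_le graph A v_gt0 theta1_ge2 theta2_ge2 u_solution n)
  (annulus_energy_le_increment graph A v_gt0 theta1_ge2 theta2_ge2 u_solution n)
  EJ (limf_einf_pinfty_ge0 u1_liminf).
move=> x.
have Dn (k : nat) : {ae leb, forall t : R, 0 <= t ->
    density v sigma u x t * testf d x0 theta1 theta2 n k.+1%:R x t = 0}.
  have k1 : 1 <= k.+1%:R :> R by rewrite ler1n.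
  apply: ray_integral_eq0.
  - exact: (integrable_density_testf d x0 theta1_ge2 theta2_ge2 u_solution).
  - move=> t t0; rewrite mulr_ge0 ?density_ge0//.
    by have /andP[] := profile01 n.+3 theta1 theta2 k.+1%:R (d x x0) t.
  rewrite -(pmulr_rle0 _ (vertex_weight_gt0 graph x)).
  apply: le_trans (E0 _ k1).
  exact: (vertex_energy_le sigma u graph A v_gt0 theta1_ge2 theta2_ge2).
have := ae_foralln (mu := leb) Dn.
apply: ae_leb_imp => t h t0.
have D0 := pseudo_metric_ge0 (A_pseudo_metric A) x x0.
(* With this radius the point (x, t) has level at most 1, where the cutoff is 1. *)
pose k := Num.truncn (d x x0 `^ theta1 + t `^ theta2).
have := h k t0; rewrite /testf /profile cutoff_eq1 ?mulr1.
  move=> /eqP; rewrite mulf_eq0 gt_eqF/= ?v_gt0//.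
  by rewrite powR_eq0 normr_eq0 => /andP[/eqP].
have kn : d x x0 `^ theta1 + t `^ theta2 <= k.+1%:R by rewrite ltW// truncnS_gt.
have k1 : 1 <= k.+1%:R :> R by rewrite ler1n.
have k2 : k.+1%:R <= (k.+1%:R : R) `^ theta1 by rewrite le1r_powR//; lra.
rewrite /level ler_pdivrMr ?powR_gt0//; lra.
Qed.
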